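(* Let $(Z_n)_{n\ge0}$ be a linear fractional Galton–Watson process in i.i.d. random environment (as in the context) which is subcritical, i.e. $R^{(-1)}_\infty<\infty=R_\infty$ a.s.; for $0\le m\le n$ let $Z_{m,n}$ be the number of individuals of generation $m$ having at least one descendant in generation $n$. (a) Let $(m_n)_{n\ge1}$ be integers with $0\le m_n\le n$ and $n-m_n\to\infty$. Then $$\lim_{n\to\infty}\mathbb{E}\,\mathbf{P}^{(1:n)}(Z_{m_n,n}>1\mid Z_n>0)=0\quad\text{and}\quad \mathbf{P}^{(n:1)}(Z_{m_n,n}>1\mid Z_n>0)\xrightarrow{n\to\infty}0\ \text{a.s.}$$ If furthermore $\limsup_{n\to\infty}n^{-1}m_n<1$, $\mathbb{E}\log^2A<\infty$ and $\mathbb{E}\log^2B<\infty$, then also $\mathbf{P}^{(1:n)}(Z_{m_n,n}>1\mid Z_n>0)\to0$ a.s. (b) Fix $m\in\mathbb{N}$ and, given the environment, let $(Z^*_k)_{0\le k\le m}$ be a Galton–Watson process in varying environment with initial law $\mathrm{Geom}_+\big(\frac{1+R^{(-1)}_m}{1+R^{(-1)}_\infty}\big)$, in which each individual of generation $k$ ($0\le k\le m-1$) independently has offspring law $\mathrm{Geom}_+\big(\frac{1+R^{(-1)}_{m-k-1}}{1+R^{(-1)}_{m-k}}\big)$; denote its conditional law given the environment by $\mathbf{P}^{(m:1)}$. Then $$\big\|\mathbf{P}^{(n:1)}((Z_{k,n})_{n-m\le k\le n}\in\cdot\mid Z_n>0)-\mathbf{P}^{(m:1)}((Z^*_k)_{0\le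 k\le m}\in\cdot)\big\|\xrightarrow{n\to\infty}0\quad\text{a.s.}$$
   Context: Let $(A_n,B_n)_{n\ge1}$ be i.i.d. copies of $(A,B)$ with $\mathbb{P}(A>0,B>0,A+B\ge1)=1$; $e_n=(A_n,B_n)$. For $a,b>0$, $a+b\ge1$, $LF(a,b)$ is the distribution on $\mathbb{N}_0$ whose generating function $f$ satisfies $1/(1-f(s))=a/(1-s)+b$, $s\in[0,1)$. $\mathrm{Geom}_+(p)$ is the geometric law on $\{1,2,\dots\}$ with weights $p(1-p)^{k-1}$. $(Z_n)$, $Z_0=1$: given the environment, each individual of generation $k-1$ independently has offspring law $LF(A_k,B_k)$. $\Pi_0=1$, $\Pi_n=\prod_{k=1}^nA_k$, $R_n=\sum_{k=1}^n\Pi_{k-1}B_k$, $R_\infty=\lim R_n$, $R^{(-1)}_0=0$, $R^{(-1)}_n=\sum_{k=1}^n\Pi_k^{-1}B_k$, $R^{(-1)}_\infty=\lim R^{(-1)}_n$. $\mathbf{P}^{(1:n)}=\mathbb{P}(\cdot\mid e_1,\dots,e_n)$; $\mathbf{P}^{(n:1)}$ is the quenched law of the process in the reversed environment: given $(e_1,\dots,e_n)$, individuals of generation $k-1$ ($1\le k\le n$) have offspring law $LF(A_{n-k+1},B_{n-k+1})$. $\|\cdot\|$ is total variation. *)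

(* Defs.v *)
From HB Require Import structures.
From mathcomp Require Import all_boot all_order all_algebra.
From mathcomp Require Import all_classical all_reals all_analysis.
Set Implicit Arguments. Unset Strict Implicit. Unset Printing Implicit Defensive.
Import Order.TTheory GRing.Theory Num.Theory.
Import numFieldNormedType.Exports.
Local Open Scope classical_set_scope.
Local Open Scope ring_scope.

Section Defs.
Variable R : realType.

Definition genfun (p : nat -> R) (s : R) : R :=
  limn (series (fun k => p k * s ^+ k)).

Definition is_LF (a b : R) (p : nat -> R) : Prop :=
  (forall k, 0 <= p k) /\ (series p @ \oo --> (1 : R)) /\
  (forall s, 0 <= s -> s < 1 -> (1 - genfun p s)^-1 = a / (1 - s) + b).

Definition geomp (q : R) (k : nat) : R :=
  if k is k'.+1 then q * (1 - q) ^+ k' else 0.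

Definition Pi (A : nat -> R) (n : nat) : R := \prod_(1 <= k < n.+1) A k.
Definition Rn (A B : nat -> R) (n : nat) : R :=
  \sum_(1 <= k < n.+1) Pi A k.-1 * B k.
Definition Rinv (A B : nat -> R) (n : nat) : R :=
  \sum_(1 <= k < n.+1) (Pi A k)^-1 * B k.
Definition Rinv_inf (A B : nat -> R) : R := limn (Rinv A B).

(* A tree up to generation n is encoded by t : seq (seq nat) of size n; the
   list nth [::] t k gives, in order, the numbers of children of the
   individuals of generation k (k = 0..n-1).  Generation 0 consists of a
   single individual. *)
Definition gen_size (t : seq (seq nat)) (k : nat) : nat :=
  if k is k'.+1 then sumn (nth [::] t k') else 1.

Definition valid_tree (n : nat) (t : seq (seq nat)) : Prop :=
  size t = n /\ forall k, (k < n)%N -> size (nth [::] t k) = gen_size t k.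

Definition tree_mass (p : nat -> nat -> R) (t : seq (seq nat)) : R :=
  \prod_(k < size t) \prod_(x <- nth [::] t k) p k x.

(* surv t k d : for each individual of generation k (in order), whether it
   has at least one descendant in generation k + d *)
Fixpoint surv (t : seq (seq nat)) (k d : nat) : seq bool :=
  match d with
  | 0 => nseq (gen_size t k) true
  | d'.+1 =>
      let s := surv t k.+1 d' in
      let c := nth [::] t k in
      [seq has id (take (nth 0 c j) (drop (sumn (take j c)) s))
         | j <- iota 0 (size c)]
  end.

Definition Zmn (t : seq (seq nat)) (m n : nat) : nat :=
  count id (surv t m (n - m)).

Definition qprob (p : nat -> nat -> R) (n : nat)
    (E : set (seq (seq nat))) : \bar R :=
  \esum_(t in [set t | valid_tree n t /\ E t]) (tree_mass p t)%:E.

Definition qP (p : nat -> nat -> R) (n : nat) (E : set (seq (seq nat))) : R :=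
  fine (qprob p n E).

Definition qP_surv (p : nat -> nat -> R) (n : nat)
    (E : set (seq (seq nat))) : R :=
  qP p n (E `&` [set t | (0 < Zmn t n n)%N]) /
  qP p n [set t | (0 < Zmn t n n)%N].

Definition env_fwd (lf : R -> R -> nat -> R) (A B : nat -> R) (n : nat) :
  nat -> nat -> R := fun k => lf (A k.+1) (B k.+1).
Definition env_rev (lf : R -> R -> nat -> R) (A B : nat -> R) (n : nat) :
  nat -> nat -> R := fun k => lf (A (n - k)%N) (B (n - k)%N).

(* The process Z^* of part (b): encoded as a tree of height m+1 whose
   generation 0 is a virtual ancestor with offspring law
   Geom_+((1+R^{-1}_m)/(1+R^{-1}_oo)); then Z^*_k = size of generation k+1,
   and individuals of generation k+1 (k = 0..m-1) have offspring law
   Geom_+((1+R^{-1}_{m-k-1})/(1+R^{-1}_{m-k})). *)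
Definition star_laws (A B : nat -> R) (m : nat) : nat -> nat -> R :=
  fun k => match k with
           | 0 => geomp ((1 + Rinv A B m) / (1 + Rinv_inf A B))
           | k'.+1 => geomp ((1 + Rinv A B (m - k'.+1)%N) /
                             (1 + Rinv A B (m - k')%N))
           end.

Definition star_law (A B : nat -> R) (m : nat) (S : set (seq nat)) : R :=
  qP (star_laws A B m) m.+1
     [set t | S [seq gen_size t k.+1 | k <- iota 0 m.+1]].

Definition reduced_law (lf : R -> R -> nat -> R) (A B : nat -> R)
    (m n : nat) (S : set (seq nat)) : R :=
  qP_surv (env_rev lf A B n) n
    [set t | S [seq Zmn t ((n - m) + k)%N n | k <- iota 0 m.+1]].

Definition tv (mu nu : set (seq nat) -> R) : \bar R :=
  ereal_sup [set (`|mu S - nu S|)%:E | S in [set: set (seq nat)]].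

End Defs.

Section Env.
Context {R : realType} {d : measure_display} {Omega : measurableType d}.
Local Open Scope ereal_scope.

Definition env_pair (A B : nat -> Omega -> R) (k : nat) : Omega -> R * R :=
  fun w => (A k w, B k w).

Definition iid_env (P : probability Omega R) (A B : nat -> Omega -> R) : Prop :=
  (forall k, (0 < k)%N ->
     measurable_fun setT (A k) /\ measurable_fun setT (B k)) /\
  (forall k (C : set (R * R)), (0 < k)%N -> measurable C ->
     P (env_pair A B k @^-1` C) = P (env_pair A B 1 @^-1` C)) /\
  (forall (I : seq nat) (C : nat -> set (R * R)),
     uniq I -> all (leq 1) I -> (forall k, measurable (C k)) ->
     P (\bigcap_(k in [set` I]) (env_pair A B k @^-1` C k)) =
     \prod_(k <- I) P (env_pair A B k @^-1` C k)).
End Env.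

(* Main.v *)
(** Write 1/u_k for the survival probability to generation n of an individual of
generation k; the defining relation of LF(a,b) gives u_k = a_k u_{k+1} + b_k.
Thinning an LF law by a survival probability, then conditioning on being
nonempty, leaves a geometric law, so given survival the reduced process
(Z_{k,n})_k is itself a branching process, with geometric offspring laws of
parameters a_k u_{k+1} / u_k.  Geometric laws compose by multiplying their
parameters, hence Z_{m,n} is geometric with parameter Pi_m u_m / u_0.

In the environment e_1, ..., e_n this gives P(Z_{m,n} > 1 | Z_n > 0) =
R_m / (Pi_n + R_n), and in the reversed environment
(R^{-1}_n - R^{-1}_{n-m}) / (1 + R^{-1}_n), which tends to 0 since R^{-1}
converges; exchangeability transfers this to the annealed forward probability.
For (b) the reduced process and Z^* differ only in the parameter of their
initial law, and two geometric laws are at distance at most |Q - q| / q.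

For the almost sure forward statement, the strong law applied to log A and
log B_n = o(n) reduce everything to E log A > 0.  This follows from
R^{-1}_oo = (B_1 + R') / A_1, where R' has the law of R^{-1}_oo: the variable
log R^{-1}_oo - log R' + log A_1 is positive, and the (possibly not integrable)
coboundary log R^{-1}_oo - log R' contributes at most 0 to the mean, by
truncation and Fatou's lemma. *)
Require Import Defs.
From HB Require Import structures.
From mathcomp Require Import all_boot all_order all_algebra.
From mathcomp Require Import all_classical all_reals all_analysis.
From mathcomp Require Import measurable_realfun zify ring lra.
Set Implicit Arguments. Unset Strict Implicit. Unset Printing Implicit Defensive.
Import Order.TTheory GRing.Theory Num.Theory.
Import numFieldNormedType.Exports.
Local Open Scope classical_set_scope.
Local Open Scope ring_scope.

(** * Sums over forests *)

(** The obstacle is that [Zmn] looks into the future: whether an individual counts in Z_{m,n}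
    depends on all generations up to n. Hence the branching property of the reduced process is
    proved from the last generation backwards, jointly for the survival flags of the roots and the
    reduced sizes, since one step back needs the flags of the children and not merely their number.
    Probabilities are sums over encoded trees; they are rewritten as iterated sums in [0, +oo]
    applied to test functions with values in [0, 1], so that interchanging sums needs no summability
    condition. The geometric laws come from one principle: a bounded functional with Psi f = c f(b)
    + d Psi(f shifted by one) is a geometric series. It gives both the thinning of an LF law and the
    composition of geometric laws. Generating functions enter only to show that the defining
    relation determines LF(a,b). The logarithms of A have a second moment, so the strong law needs
    only pairwise independence and variances along the squares. *)

Section NestedSums.
Variable R : realType.
Local Open Scope ereal_scope.
Implicit Types (p : nat -> R) (P : nat -> nat -> R).

Definition nng {T} (f : T -> \bar R) := forall x, 0 <= f x.
Definition wge0 p := forall k, (0 <= p k)%R.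

(** This and the next three are expectations: under one law, over the offspring counts of [x]
    individuals, over the forests of height [n] that they grow, and over [n] independent flags of
    success probability [s]. Conditioning on the first individual or generation is then the
    unfolding of a definition. *)
Definition wsum p (f : nat -> \bar R) : \bar R := \sum_(y <oo) (p y)%:E * f y.

Fixpoint vsum p (x : nat) (f : seq nat -> \bar R) : \bar R :=
  if x is x'.+1 then wsum p (fun y => vsum p x' (fun l => f (y :: l)))
  else f [::].

Fixpoint fsum (n : nat) P (x : nat) (g : seq (seq nat) -> \bar R) : \bar R :=
  if n is n'.+1 then
    vsum (P 0%N) x (fun l => fsum n' (fun k => P k.+1) (sumn l) (fun t => g (l :: t)))
  else g [::].

Fixpoint bsum (s : R) (n : nat) (f : seq bool -> \bar R) : \bar R :=
  if n is n'.+1 then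
    (1 - s)%:E * bsum s n' (fun u => f (false :: u)) +
    s%:E * bsum s n' (fun u => f (true :: u))
  else f [::].

Lemma wsum_ge0 p f : wge0 p -> nng f -> 0 <= wsum p f.
Proof.
by move=> p0 f0; apply: nneseries_ge0 => k _ _; rewrite mule_ge0 ?lee_fin.
Qed.

Lemma vsum_ge0 p x f : wge0 p -> nng f -> 0 <= vsum p x f.
Proof.
move=> p0; elim: x f => [|x IH] f f0 /=; first exact: f0.
by apply: wsum_ge0 => // y; apply: IH => l.
Qed.

Lemma fsum_ge0 n P x g : (forall k, wge0 (P k)) -> nng g -> 0 <= fsum n P x g.
Proof.
elim: n P x g => [|n IH] P x g p0 g0 /=; first exact: g0.
by apply: vsum_ge0 => // l; apply: IH.
Qed.

Lemma bsum_ge0 s n f : (0 <= s <= 1)%R -> nng f -> 0 <= bsum s n f.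
Proof.
move=> /andP[s0 s1]; elim: n f => [|n IH] f f0 /=; first exact: f0.
by rewrite adde_ge0// mule_ge0 ?IH// lee_fin ?subr_ge0.
Qed.

Lemma le_wsum p f g : wge0 p -> nng f -> (forall y, f y <= g y) ->
  wsum p f <= wsum p g.
Proof.
move=> p0 f0 fg; apply: lee_nneseries => [i _ _|i _].
  by rewrite mule_ge0 ?lee_fin.
by rewrite lee_wpmul2l ?lee_fin.
Qed.

Lemma le_vsum p x f g : wge0 p -> nng f -> (forall y, f y <= g y) ->
  vsum p x f <= vsum p x g.
Proof.
move=> p0; elim: x f g => [|x IH] f g f0 fg /=; first exact: fg.
by apply: le_wsum => // y; [apply: vsum_ge0 | apply: IH].
Qed.

Lemma wsumD p f g : wge0 p -> nng f -> nng g ->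
  wsum p (fun y => f y + g y) = wsum p f + wsum p g.
Proof.
move=> p0 f0 g0; rewrite /wsum -nneseriesD; [|move=> i _ _; by rewrite mule_ge0 ?lee_fin..].
by apply: eq_eseriesr => i _; rewrite ge0_muleDr.
Qed.

Lemma wsumZ p c f : wge0 p -> nng f ->
  wsum p (fun y => c%:E * f y) = c%:E * wsum p f.
Proof.
move=> p0 f0; rewrite /wsum -nneseriesZl; last by move=> i _; rewrite mule_ge0 ?lee_fin.
by apply: eq_eseriesr => i _; rewrite muleCA.
Qed.

Lemma vsumZ p x c f : wge0 p -> nng f ->
  vsum p x (fun y => c%:E * f y) = c%:E * vsum p x f.
Proof.
move=> p0; elim: x f => [//|x IH] f f0 /=.
rewrite -wsumZ//; last by move=> y; apply: vsum_ge0.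
by congr wsum; apply/funext => y; rewrite IH.
Qed.

Lemma bsum_wsum s n p (f : seq bool -> nat -> \bar R) : (0 <= s <= 1)%R ->
  wge0 p -> (forall u, nng (f u)) ->
  bsum s n (fun u => wsum p (f u)) = wsum p (fun c => bsum s n (f^~ c)).
Proof.
move=> s01 p0; elim: n f => [//|n IH] f f0 /=.
have /andP[? ?] := s01.
have b0 b c : 0 <= bsum s n (fun u => f (b :: u) c) by apply: bsum_ge0 => // u; apply: f0.
have c0 (c : R) b : (0 <= c)%R -> nng (fun k => c%:E * bsum s n (fun u => f (b :: u) k)).
  by move=> ? k; rewrite mule_ge0 ?lee_fin.
rewrite wsumD//; try by apply: c0; rewrite ?subr_ge0.
by rewrite !wsumZ//; [rewrite !IH// => u; apply: f0|move=> k; apply: b0..].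
Qed.

Lemma vsum_bsum p x s n (f : seq nat -> seq bool -> \bar R) : (0 <= s <= 1)%R ->
  wge0 p -> (forall l, nng (f l)) ->
  vsum p x (fun l => bsum s n (f l)) = bsum s n (fun u => vsum p x (f^~ u)).
Proof.
move=> s01 p0; elim: x f => [//|x IH] f f0 /=.
rewrite bsum_wsum//; last by move=> u y; apply: vsum_ge0 => // l; apply: f0.
by congr wsum; apply/funext => y; rewrite IH// => l; apply: f0.
Qed.

Lemma bsum_cat s m n f :
  bsum s (m + n) f = bsum s m (fun u => bsum s n (fun v => f (u ++ v))).
Proof. by elim: m f => [//|m IH] f /=; rewrite !IH. Qed.

Lemma eq_bsum s n f g : (forall u, size u = n -> f u = g u) -> bsum s n f = bsum s n g.
Proof.
elim: n f g => [|n IH] f g fg /=; first exact: fg.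
by congr (_ * _ + _ * _); apply: IH => u un; apply: fg => /=; rewrite un.
Qed.

Lemma eq_vsum p n f g : (forall u, size u = n -> f u = g u) -> vsum p n f = vsum p n g.
Proof.
elim: n f g => [|n IH] f g fg /=; first exact: fg.
by congr wsum; apply/funext => y; apply: IH => u un; apply: fg => /=; rewrite un.
Qed.

(** Validity with an arbitrary number of roots, as the induction on generations needs; the height is
    kept apart, as [size t]. *)
Fixpoint forest (x : nat) (t : seq (seq nat)) : Prop :=
  if t is l :: t' then size l = x /\ forest (sumn l) t' else True.

Lemma eq_fsum n P x f g :
  (forall t, size t = n -> forest x t -> f t = g t) -> fsum n P x f = fsum n P x g.
Proof.
elim: n P x f g => [|n IH] P x f g fg /=; first exact: fg.
by apply: eq_vsum => l lx; apply: IH => t tn wt; apply: fg => //=; rewrite tn.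
Qed.

Lemma valid_treeE n t : valid_tree n t <-> size t = n /\ forest 1 t.
Proof.
rewrite /valid_tree.
suff H x : size t = n -> (forall k, (k < n)%N -> size (nth [::] t k) =
   if k is k'.+1 then sumn (nth [::] t k') else x) <-> forest x t.
  by split=> -[tn h]; split=> //; apply/(H 1%N tn).
elim: n t x => [|n IH] [|l t] x //= [tn]; split.
- move=> h; split; first exact: (h 0%N).
  by apply/(IH t) => // -[|k] kn; [exact: (h 1%N)|exact: (h k.+2)].
- by move=> [lx wt] [|[|k]]// kn; move/(IH t _ tn) : wt; [move/(_ 0%N)|move/(_ k.+1)]; exact.
Qed.

Lemma esumZl (T : choiceType) (S : set T) (c : R) (a : T -> \bar R) :
  (0 <= c)%R -> (forall x, S x -> 0 <= a x) ->
  \esum_(i in S) (c%:E * a i) = c%:E * \esum_(i in S) a i.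
Proof.
have le (d : R) (b : T -> \bar R) : (0 <= d)%R -> (forall x, S x -> 0 <= b x) ->
  \esum_(i in S) (d%:E * b i) <= d%:E * \esum_(i in S) b i.
  move=> d0 b0; apply: ub_ereal_sup => _ [X [fX XS] <-].
  rewrite (_ : \sum_(i \in X) _ = d%:E * \sum_(i \in X) b i).
    apply: lee_wpmul2l; first by rewrite lee_fin.
    by apply: ereal_sup_ubound; exists X.
  transitivity (\sum_(i \in X) (d%:E * (if i \in S then b i else 0))).
    by apply: eq_fsbigr => i /set_mem /XS /mem_set ->.
  rewrite -ge0_mule_fsumr; last by move=> i; case: ifPn => // /set_mem/b0.
  by congr (_ * _); apply: eq_fsbigr => i /set_mem /XS /mem_set ->.
move=> c0 a0; apply/eqP; rewrite eq_le le//=.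
have [->|cN0] := eqVneq c 0%R; first by rewrite mul0e esum_ge0// => *; rewrite mul0e.
have cp : (0 < c)%R by rewrite lt_def cN0.
(* The reverse inequality is [le] for the factor [c^-1] and the family [c * a]. *)
rewrite [X in _ * X](_ : _ = \esum_(i in S) (c^-1%:E * (c%:E * a i))).
  apply: (@le_trans _ _ (c%:E * (c^-1%:E * \esum_(i in S) (c%:E * a i)))).
    apply: lee_wpmul2l; rewrite ?lee_fin//; apply: le; rewrite ?invr_ge0// => x Sx.
    by rewrite mule_ge0 ?a0.
  by rewrite muleA -EFinM divff// mul1e.
by apply: eq_esum => i _; rewrite muleA -EFinM mulVf// mul1e.
Qed.

(** Serves twice: for lists of offspring counts split at the first individual, and for forests split
    at the first generation, where the set of tails depends on the head. *)
Lemma esum_cons (T : choiceType) (S : set T) (S' : T -> set (seq T)) (Q : set (seq T))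
   (f : seq T -> \bar R) : nng f ->
  Q = [set t | exists y l, [/\ t = y :: l, S y & S' y l]] ->
  \esum_(t in Q) f t = \esum_(y in S) \esum_(l in S' y) f (y :: l).
Proof.
move=> f0 ->; rewrite esum_esum; last by move=> *; apply: f0.
apply: reindex_esum; split.
- by move=> [y l] [/= Sy Sl]; exists y, l.
- by move=> [y l] [y' l'] _ _ /= [-> ->].
- by move=> t [y [l [-> Sy Sl]]]; exists (y, l).
Qed.

Lemma vsumE p x f : wge0 p -> nng f ->
  vsum p x f = \esum_(l in [set l | size l = x]) ((\prod_(y <- l) p y)%:E * f l).
Proof.
move=> p0; elim: x f => [|x IH] f f0 /=.
  rewrite [X in esum X](_ : _ = [set [::]]) ?esum_set1 ?big_nil ?mul1e//.
  by apply/seteqP; split => l /= => [/size0nil//|->].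
have pr0 (l : seq nat) : (0 <= \prod_(y <- l) p y)%R by apply: prodr_ge0.
rewrite /wsum nneseries_esumT; last first.
  by move=> n; rewrite mule_ge0 ?lee_fin// vsum_ge0.
rewrite (@esum_cons _ setT (fun _ => [set l | size l = x])); first last.
- apply/seteqP; split => [[|y l] //= [lx]|t /= [y [l [-> _ /= ->]]]]//.
  by exists y, l.
- by move=> l; rewrite mule_ge0 ?lee_fin.
apply: eq_esum => y _; rewrite IH// -esumZl//; last by move=> l _; rewrite mule_ge0 ?lee_fin.
by apply: eq_esum => l _; rewrite big_cons muleA EFinM.
Qed.

Lemma tree_mass_cons P l t :
  tree_mass P (l :: t) =
  ((\prod_(y <- l) P 0%N y) * tree_mass (fun k => P k.+1) t)%R.
Proof. by rewrite /tree_mass /= big_ord_recl. Qed.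

Lemma tree_mass_ge0 P t : (forall k, wge0 (P k)) -> (0 <= tree_mass P t)%R.
Proof. by move=> P0; apply: prodr_ge0 => k _; apply: prodr_ge0 => x _; apply: P0. Qed.

Lemma fsumE n P x g : (forall k, wge0 (P k)) -> nng g ->
  fsum n P x g =
  \esum_(t in [set t | size t = n /\ forest x t]) ((tree_mass P t)%:E * g t).
Proof.
elim: n P x g => [|n IH] P x g P0 g0 /=.
  rewrite [X in esum X](_ : _ = [set [::]]); last first.
    by apply/seteqP; split => l /= => [[/size0nil]//|->].
  by rewrite esum_set1 /tree_mass /= big_ord0 mul1e.
have m0 Q t : (forall k, wge0 (Q k)) -> (0 <= tree_mass Q t)%R by exact: tree_mass_ge0.
rewrite (@esum_cons _ [set l | size l = x] (fun l => [set t | size t = n /\ forest (sumn l) t])); first last.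
- apply/seteqP; split => [[|y l] [//=[ln] [yx fl]]|t /= [y [l [-> /= -> [-> ?]]]]]//.
  by exists y, l.
- by move=> l; rewrite mule_ge0 ?lee_fin//; apply: m0.
rewrite vsumE//; last by move=> l; apply: fsum_ge0 => // k; apply: P0.
apply: eq_esum => l _; have P0' k : wge0 (P k.+1) by apply: P0.
rewrite IH// -esumZl.
- by apply: eq_esum => t _; rewrite tree_mass_cons muleA EFinM.
- by apply: prodr_ge0 => *; apply: P0.
- by move=> t _; rewrite mule_ge0 ?lee_fin//; apply: m0.
Qed.

Lemma qprob_fsum P n (E : set (seq (seq nat))) : (forall k, wge0 (P k)) ->
  qprob P n E = fsum n P 1 (fun t => (\1_E t)%:E).
Proof.
move=> P0; rewrite fsumE//.
rewrite /qprob (_ : [set t | _ /\ _] = [set t | size t = n /\ forest 1 t] `&` E).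
  rewrite esum_mkcondr; apply: eq_esum => t _; rewrite indicE.
  by case: (t \in E); rewrite ?mule1 ?mule0.
by apply/seteqP; split=> t /= [/valid_treeE].
Qed.

End NestedSums.

(** * Linear fractional and geometric laws *)

Section PowerSeries.
Variable R : realType.

(** Identity theorem for power series, needed because LF(a,b) is given only through its generating
    function. The constant term is at most s C / (1 - s) for every s in (0, 1), hence zero; dividing
    the series by s passes to the next coefficient. *)
Lemma power_series0 (D : nat -> R) (C : R) : (forall k, `|D k| <= C) ->
  (forall s : R, 0 < s -> s < 1 -> series (fun k => D k * s ^+ k) @ \oo --> (0 : R)) ->
  forall k, D k = 0.
Proof.
have recl (f : nat -> R) (s : R) n : series (fun k => f k * s ^+ k) n.+1 =
    f 0%N + s * series (fun k => f k.+1 * s ^+ k) n.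
  rewrite !seriesEnat /= big_nat_recl// expr0 mulr1; congr (_ + _).
  by rewrite big_distrr/=; apply: eq_bigr => i _; rewrite exprS mulrCA.
have base (f : nat -> R) : (forall k, `|f k| <= C) ->
  (forall s : R, 0 < s -> s < 1 -> series (fun k => f k * s ^+ k) @ \oo --> (0 : R)) ->
  f 0%N = 0.
  move=> fC f0; have C0 : 0 <= C by apply: le_trans (fC 0%N).
  have key s : 0 < s -> s < 1 -> `|f 0%N| <= s * (C / (1 - s)).
    move=> s0 s1; apply/ler_addgt0Pr => e e0.
    have /cvgrPdist_le/(_ e e0) := f0 s s0 s1.
    move=> [N _ /(_ N.+1 (leqnSn _))] /=; rewrite sub0r normrN recl => h.
    have -> : f 0%N = (f 0%N + s * series (fun k => f k.+1 * s ^+ k) N) -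
      s * series (fun k => f k.+1 * s ^+ k) N by rewrite addrK.
    apply: le_trans (ler_normB _ _) _; rewrite addrC; apply: lerD => //.
    rewrite normrM gtr0_norm// ler_pM2l//.
    apply: le_trans (geometric_le_lim N C0 s0 _); last by rewrite gtr0_norm.
    rewrite !seriesEnat /=; apply: le_trans (ler_norm_sum _ _ _) _.
    apply: ler_sum => i _; rewrite normrM ler_pM// normrX gtr0_norm//.
  apply/eqP; rewrite -normr_eq0; apply/eqP/le_anti; rewrite normr_ge0 andbT.
  rewrite leNgt; apply/negP => e0; set e : R := `|f 0%N| in e0 key.
  have d0 : 0 < 2 * C + 2 * e by nra.
  (* For this s the bound s C / (1 - s) equals e C / (2 C + e), which is below e. *)
  have := key (e / (2 * C + 2 * e)); rewrite divr_gt0// ltr_pdivrMr// => /(_ isT).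
  have -> : e < 1 * (2 * C + 2 * e) by nra.
  move=> /(_ isT); have -> : e / (2 * C + 2 * e) * (C / (1 - e / (2 * C + 2 * e))) =
     e * (C / (2 * C + e)).
    by field; apply/andP; split; lra.
  apply/negP; rewrite -ltNge gtr_pMr// ltr_pdivrMr; nra.
move=> + + k; elim: k D => [|k IH] D DC D0; first exact: base.
apply: (IH (fun k => D k.+1)) => [j|s s0 s1]; first exact: DC.
have D00 := base _ DC D0.
have := cvgM (cvg_cst s^-1) (D0 s s0 s1); rewrite mulr0 -cvg_shiftS.
move=> h; have -> : series (fun k => D k.+1 * s ^+ k) =
    (fun n => (cst s^-1 \* series (fun k => D k * s ^+ k)) n.+1).
  by apply/funext => n /=; rewrite recl D00 add0r mulKf ?gt_eqF.
exact: h.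
Qed.

Lemma is_LF_uniq (a b : R) (p q : nat -> R) : is_LF a b p -> is_LF a b q ->
  0 < a -> 0 < b -> p = q.
Proof.
move=> [p0 [p1 pf]] [q0 [q1 qf]] a0 b0; apply/funext => k; apply/eqP.
have le1 (f : nat -> R) : (forall k, 0 <= f k) -> series f @ \oo --> (1 : R) ->
    forall k, f k <= 1.
  move=> f0 f1 j; have nd : nondecreasing_seq (series f).
    by apply/nondecreasing_seqP => n; rewrite seriesSr lerDl.
  have := nondecreasing_cvgn_le nd (cvgP _ f1) j.+1; rewrite (cvg_lim _ f1)//.
  by apply: le_trans; rewrite seriesSr lerDr; apply: sumr_ge0.
(* [genfun] is a bare limit and carries information only once convergence is known, here by
   comparison with the series of the weights. *)
have cv (f : nat -> R) s : (forall k, 0 <= f k) -> series f @ \oo --> (1 : R) ->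
    0 < s -> s < 1 -> series (fun k => f k * s ^+ k) @ \oo --> genfun f s.
  move=> f0 f1 s0 s1; apply: (@series_le_cvg _ _ f) => [n|//|n|].
  - by rewrite mulr_ge0// exprn_ge0// ltW.
  - by rewrite ler_piMr// exprn_ile1// ltW.
  - exact: cvgP f1.
rewrite -subr_eq0; apply/eqP; apply: (@power_series0 (fun k => p k - q k) 2).
  move=> j; apply: le_trans (ler_normB _ _) _.
  have := p0 j; have := q0 j; move=> ? ?; rewrite !ger0_norm//.
  have := le1 _ p0 p1 j; have := le1 _ q0 q1 j; lra.
move=> s s0 s1; have := cvgB (cv p s p0 p1 s0 s1) (cv q s q0 q1 s0 s1).
have -> : genfun p s = genfun q s.
  have : (1 - genfun p s)^-1 = (1 - genfun q s)^-1 by rewrite pf ?qf// ltW.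
  by move/invr_inj; lra.
rewrite subrr => h; have -> : series (fun k => (p k - q k) * s ^+ k) =
    series (fun k => p k * s ^+ k) \- series (fun k => q k * s ^+ k).
  apply/funext => n; rewrite /series/= -sumrB.
  by apply: eq_bigr => i _; rewrite mulrBl.
exact: h.
Qed.

End PowerSeries.

Section GeometricFunctional.
Variable R : realType.
Local Open Scope ereal_scope.
Implicit Types (p : nat -> R).

Definition unitf {T} (f : T -> \bar R) := forall x, 0 <= f x <= 1.

Lemma unitf_nng T (f : T -> \bar R) : unitf f -> nng f.
Proof. by move=> f01 x; have /andP[] := f01 x. Qed.

Lemma fin_unit (x : \bar R) : 0 <= x <= 1 -> x \is a fin_num.
Proof. by move=> /andP[x0 x1]; rewrite ge0_fin_numE// (le_lt_trans x1)// ltry. Qed.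

(** Iterating the recursion [n] times leaves a remainder of order [d ^+ n], by boundedness. The case
    [b = 1] is used for composing geometric laws, the case [b = 0] for thinning. *)
Lemma geom_functional (Psi : (nat -> \bar R) -> \bar R) (b : nat) (c d C : R) :
  (0 <= c)%R -> (0 <= d)%R -> (d < 1)%R ->
  (forall f, unitf f -> 0 <= Psi f <= C%:E) ->
  (forall f, unitf f -> Psi f = c%:E * f b + d%:E * Psi (fun k => f k.+1)) ->
  forall f, unitf f -> Psi f = wsum (fun k => (c * d ^+ k)%R) (fun k => f (k + b)%N).
Proof.
move=> c0 d0 d1 PsiC Psirec f f01.
have rem0 n : 0 <= (d ^+ n)%:E * Psi (fun k => f (n + k)%N).
  by rewrite mule_ge0 ?lee_fin ?exprn_ge0//; have /andP[] := PsiC (fun k => f (n + k)%N) (fun k => f01 _).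
have remC n : (d ^+ n)%:E * Psi (fun k => f (n + k)%N) <= (C * d ^+ n)%:E.
  rewrite mulrC EFinM lee_wpmul2l ?lee_fin ?exprn_ge0//.
  by have /andP[] := PsiC (fun k => f (n + k)%N) (fun k => f01 _).
have key n : \sum_(0 <= k < n) ((c * d ^+ k)%:E * f (k + b)%N) =
    Psi f - (d ^+ n)%:E * Psi (fun k => f (n + k)%N).
  suff -> : Psi f = \sum_(0 <= k < n) ((c * d ^+ k)%:E * f (k + b)%N) +
      (d ^+ n)%:E * Psi (fun k => f (n + k)%N).
    by rewrite addeK// ge0_fin_numE// (le_lt_trans (remC n))// ltry.
  elim: n => [|n IH]; first by rewrite big_nil add0e expr0 mul1e.
  rewrite {1}IH big_nat_recr//= -addeA; congr (_ + _).
  rewrite Psirec//.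
  have /andP[P0 _] := PsiC (fun k => f (n + k.+1)%N) (fun k => f01 _).
  have /andP[f0 _] := f01 (n + b)%N.
  rewrite ge0_muleDr ?mule_ge0 ?lee_fin//; congr (_ + _).
    by rewrite addnC muleA -EFinM mulrC.
  rewrite muleA -EFinM -exprSr; congr (_ * Psi _); apply/funext => k.
  by rewrite addnS.
symmetry; apply: cvg_lim => //.
rewrite (_ : (fun n => _) = (fun n => Psi f - (d ^+ n)%:E * Psi (fun k => f (n + k)%N))); last exact/funext.
rewrite -[X in _ --> X]sube0; apply: cvgeB; [by rewrite oppe0 fin_num_adde_defl|exact: cvg_cst|].
apply: (@squeeze_cvge _ _ _ _ (cst 0) _ (fun n => (C * d ^+ n)%:E)).
- by apply: nearW => n; rewrite rem0 remC.
- exact: cvg_cst.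
- by apply: cvg_EFin; [exact: nearW|apply: cvg_geometric; rewrite ger0_norm].
Qed.

Lemma wsum_geometric (c d : R) : (0 <= c)%R -> (0 <= d)%R -> (d < 1)%R ->
  wsum (fun k => (c * d ^+ k)%R) (cst 1) = (c / (1 - d))%:E.
Proof.
move=> c0 d0 d1; apply: cvg_lim => //.
under eq_fun do under eq_bigr do rewrite mule1.
under eq_fun do rewrite sumEFin.
apply: cvg_EFin; first exact: nearW.
by apply: cvg_geometric_series; rewrite ger0_norm.
Qed.

Lemma wsum_recl p f : wge0 p -> nng f ->
  wsum p f = (p 0%N)%:E * f 0%N + wsum (fun k => p k.+1) (fun k => f k.+1).
Proof.
move=> p0 f0; have h k : 0 <= (p k)%:E * f k by rewrite mule_ge0 ?lee_fin.
rewrite /wsum nneseries_recl//; congr (_ + _).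
rewrite -(@nneseries_addn _ _ 1)//; apply: eq_eseriesr => i _.
by rewrite addn1.
Qed.

Lemma wsum_scale c p f : wge0 p -> nng f ->
  wsum (fun k => (c * p k)%R) f = c%:E * wsum p f.
Proof.
move=> p0 f0; rewrite -wsumZ//; apply: eq_eseriesr => i _.
by rewrite EFinM muleCA muleA.
Qed.

Definition law p := wge0 p /\ wsum p (cst 1) = 1.

Lemma wsum_unit p f : law p -> unitf f -> 0 <= wsum p f <= 1.
Proof.
move=> [p0 p1] f01; rewrite wsum_ge0//=; last exact: unitf_nng.
rewrite -p1; apply: le_wsum => //; first exact: unitf_nng.
by move=> y; have /andP[] := f01 y.
Qed.

Lemma vsum_unit p x f : law p -> unitf f -> 0 <= vsum p x f <= 1.
Proof.
move=> lp; elim: x f => [|x IH] f f01; first exact: f01.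
by apply: wsum_unit => // y; apply: IH => l; apply: f01.
Qed.

Lemma fsum_unit n P x f : (forall k, law (P k)) -> unitf f -> 0 <= fsum n P x f <= 1.
Proof.
elim: n P x f => [|n IH] P x f lp f01; first exact: f01.
by apply: vsum_unit => // l; apply: IH => // t; apply: f01.
Qed.

Lemma bsum_unit s n f : (0 <= s <= 1)%R -> unitf f -> 0 <= bsum s n f <= 1.
Proof.
move=> s01; have /andP[s0 s1] := s01; elim: n f => [|n IH] f f01; first exact: f01.
rewrite (bsum_ge0 _ s01 (unitf_nng f01)) /=.
have /andP[? ?] := IH _ (fun u => f01 (false :: u)).
have /andP[? ?] := IH _ (fun u => f01 (true :: u)).
apply: (@le_trans _ _ ((1 - s)%:E * 1 + s%:E * 1)).
  by apply: leeD; apply: lee_wpmul2l; rewrite ?lee_fin ?subr_ge0.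
by rewrite !mule1 -EFinD subrK.
Qed.

Lemma vsum_cst p x : law p -> vsum p x (cst 1) = 1.
Proof.
move=> [p0 p1]; elim: x => [//|x IH] /=.
by rewrite -[RHS]p1; congr wsum; apply/funext.
Qed.

Lemma fsum_cst n P x : (forall k, law (P k)) -> fsum n P x (cst 1) = 1.
Proof.
elim: n P x => [//|n IH] P x lp /=; rewrite -[RHS](vsum_cst x (lp 0%N)).
by congr vsum; apply/funext => l; apply: IH.
Qed.

Section geomp.
Variable q : R.
Hypothesis q01 : (0 < q <= 1)%R.

Let q0 : (0 <= q)%R. Proof. by case/andP: q01 => /ltW. Qed.
Let q10 : (0 <= 1 - q)%R. Proof. by case/andP: q01; lra. Qed.
Let q11 : (1 - q < 1)%R. Proof. by case/andP: q01; lra. Qed.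

Lemma wge0_geom : wge0 (fun k => (q * (1 - q) ^+ k)%R).
Proof. by move=> k; rewrite mulr_ge0// exprn_ge0. Qed.

Lemma wge0_geomp : wge0 (geomp q).
Proof. by case=> [//|k]; exact: wge0_geom. Qed.

Lemma wsum_geomp f : nng f ->
  wsum (geomp q) f = wsum (fun k => (q * (1 - q) ^+ k)%R) (fun k => f k.+1).
Proof. by move=> f0; rewrite wsum_recl ?mul0e ?add0e//; exact: wge0_geomp. Qed.

Lemma law_geomp : law (geomp q).
Proof.
split; first exact: wge0_geomp.
rewrite wsum_geomp; last by move=> ?; rewrite lee_fin.
rewrite wsum_geometric// opprB addrC subrK divff//.
by case/andP: q01 => /gt_eqF ->.
Qed.

Lemma wsum_geomS f : nng f ->
  wsum (fun k => (q * (1 - q) ^+ k)%R) f = q%:E * f 0%N +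
  (1 - q)%:E * wsum (fun k => (q * (1 - q) ^+ k)%R) (fun k => f k.+1).
Proof.
move=> f0; rewrite wsum_recl//; last exact: wge0_geom.
rewrite expr0 mulr1 -wsum_scale//; last exact: wge0_geom.
by congr (_ + wsum _ _); apply/funext => k; rewrite exprS mulrCA.
Qed.

Lemma wsum_geompS f : nng f ->
  wsum (geomp q) f = q%:E * f 1%N + (1 - q)%:E * wsum (geomp q) (fun k => f k.+1).
Proof. by move=> f0; rewrite !wsum_geomp// wsum_geomS. Qed.

End geomp.

End GeometricFunctional.

Section Branching.
Variable R : realType.
Local Open Scope ereal_scope.
Implicit Types (p : nat -> R).

(** Memorylessness at two levels: the first summand is 1 with probability q and otherwise loses one
    unit and stays geometric; the number of summands behaves likewise with q0. Together this is the
    recursion of [geom_functional] with c = q0 q and d = 1 - q0 q. *)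
Lemma geomp_merge (q0 q : R) f : (0 < q0 <= 1)%R -> (0 < q <= 1)%R -> unitf f ->
  wsum (geomp q0) (fun x => vsum (geomp q) x (fun l => f (sumn l))) =
  wsum (geomp (q0 * q)) f.
Proof.
move=> q00 q01 f01.
pose M y f := vsum (geomp q) y (fun l => f (sumn l)).
have M01 y g : unitf g -> 0 <= M y g <= 1.
  by move=> g01; apply: vsum_unit; [exact: law_geomp|move=> l; exact: g01].
have M0 y g : unitf g -> 0 <= M y g by move=> /(M01 y)/andP[].
have MS y g : unitf g -> M y.+1 g =
    q%:E * M y (fun k => g k.+1) + (1 - q)%:E * M y.+1 (fun k => g k.+1).
  move=> g01; rewrite {1}/M /= wsum_geompS// => c.
  by apply: (M0 y (fun k => g (c + k)%N)) => k; apply: g01.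
pose Psi g := wsum (geomp q0) (fun y => M y g).
have Psi01 g : unitf g -> 0 <= Psi g <= 1.
  by move=> g01; apply: wsum_unit; [exact: law_geomp|move=> y; exact: M01].
have q01' : (0 < q0 * q <= 1)%R.
  case/andP: q00 => ? ?; case/andP: q01 => ? ?.
  by rewrite mulr_gt0//= mulr_ile1// ltW.
have W0 := wge0_geom q00.
transitivity (wsum (fun k => (q0 * q * (1 - q0 * q) ^+ k)%R) (fun k => f (k + 1)%N)).
  apply: (@geom_functional _ Psi 1 _ _ 1) => //; try by case/andP: q01'; lra.
  move=> g g01; pose g' k := g k.+1.
  have g'01 : unitf g' by move=> k; apply: g01.
  have E h : unitf h -> Psi h = wsum (fun k => (q0 * (1 - q0) ^+ k)%R) (fun y => M y.+1 h).
    by move=> h01; rewrite /Psi wsum_geomp// => y; apply: M0.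
  rewrite (E g)// (_ : (fun y => _) = fun y => q%:E * M y g' + (1 - q)%:E * M y.+1 g'); last first.
    by apply/funext => y; rewrite MS.
  have q0' : (0 <= q)%R by case/andP: q01 => /ltW.
  have q1' : (0 <= 1 - q)%R by case/andP: q01; rewrite subr_ge0.
  rewrite wsumD//; [|by move=> y; rewrite mule_ge0 ?lee_fin ?M0..].
  rewrite !wsumZ//; [|by move=> y; apply: M0..].
  rewrite wsum_geomS//; last by move=> y; apply: M0.
  rewrite -E// {1}/M /= -/(g' 0%N) -/g'.
  have := fin_unit (Psi01 _ g'01); have := fin_unit (g'01 0%N).
  move: (Psi g') (g' 0%N) => [x| |]// [y| |]// _ _.
  by rewrite -?(EFinM, EFinD); congr EFin; ring.
rewrite [RHS]wsum_geomp//; last by apply: unitf_nng.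
by congr wsum; apply/funext => k; rewrite addn1.
Qed.

(** Solving the defining relation gives f(s) = 1 - (1 - s) / (a + b - b s), whose coefficients are
    an atom at 0 followed by a geometric sequence of ratio b / (a + b). *)
Definition pLF (a b : R) (k : nat) : R :=
  (if k is k'.+1 then a / (a + b) ^+ 2 * (b / (a + b)) ^+ k'
  else 1 - (a + b)^-1)%R.

Lemma pLF_series (a b s : R) : (0 < a -> 0 < b -> 0 <= s -> s <= 1 ->
  series (fun k => pLF a b k * s ^+ k) @ \oo --> 1 - (1 - s) / (a + b - b * s))%R.
Proof.
move=> a0 b0 s0 s1.
have bs : (b * s <= b)%R by rewrite ler_piMr// ltW.
have nrm : (`|b / (a + b) * s| < 1)%R.
  rewrite ger0_norm; last by rewrite mulr_ge0// divr_ge0//; lra.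
  by rewrite mulrAC ltr_pdivrMr; lra.
have -> : (1 - (1 - s) / (a + b - b * s) =
  1 - (a + b)^-1 + a / (a + b) ^+ 2 * s / (1 - b / (a + b) * s))%R.
  by field; rewrite !gt_eqF//=; lra.
rewrite -cvg_shiftS.
rewrite (_ : (fun n => _) = (fun n => (1 - (a + b)^-1) +
    series (geometric (a / (a + b) ^+ 2 * s) (b / (a + b) * s)) n)%R); last first.
  apply/funext => n; rewrite !seriesEnat /= big_nat_recl//= expr0 mulr1.
  congr (_ + _)%R; apply: eq_bigr => i _.
  by rewrite [(s ^+ i.+1)%R]exprS [((_ * s) ^+ i)%R]exprMn mulrACA.
by apply: cvgD; [exact: cvg_cst|exact: cvg_geometric_series].
Qed.

Lemma is_LF_pLF (a b : R) : (0 < a -> 0 < b -> 1 <= a + b -> is_LF a b (pLF a b))%R.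
Proof.
move=> a0 b0 ab; split; [|split].
- move=> [|k] /=; first by rewrite subr_ge0 invf_le1//; lra.
  by rewrite mulr_ge0 ?exprn_ge0 ?divr_ge0 ?exprn_ge0//; lra.
- have := pLF_series a0 b0 ler01 (lexx 1%R).
  rewrite subrr mul0r subr0 (_ : (fun k => _ * _)%R = pLF a b)//.
  by apply/funext => k; rewrite expr1n mulr1.
- move=> s s0 s1; rewrite /genfun (cvg_lim _ (pLF_series a0 b0 s0 (ltW s1)))//.
  have bs : (b * s <= b)%R by rewrite ler_piMr// ltW.
  field; rewrite !gt_eqF//=; lra.
Qed.

(** When the children of a parent with offspring law [p] survive independently with probability [s],
    the parent has a surviving child with probability [s'], and given this the number of surviving
    children has law [r]. *)
Definition thins p (s s' : R) (r : nat -> R) :=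
  forall h : bool -> nat -> \bar R, (forall b, unitf (h b)) ->
  wsum p (fun l => bsum s l (fun u => h (has id u) (count id u))) =
  (1 - s')%:E * h false 0%N + s'%:E * wsum r (h true).

(** For u = 1/s the new inverse survival probability is a u + b. The weights of an LF law beyond 0
    are geometric, so the binomial averages of a test function satisfy a one-step recursion in the
    number of children. *)
Lemma thins_LF (a b : R) p (s : R) : is_LF a b p ->
  (0 < a -> 0 < b -> 1 <= a + b -> 0 < s <= 1 ->
  thins p s (s / (a + b * s)) (geomp (a / (a + b * s))))%R.
Proof.
move=> LFp a0 b0 ab s01; have /andP[s0 s1] := s01.
rewrite (is_LF_uniq LFp (is_LF_pLF a0 b0 ab) a0 b0) => h h01.
have s01' : (0 <= s <= 1)%R by rewrite (ltW s0).
have bs0 : (0 < b * s)%R by rewrite mulr_gt0.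
have abs : (a + b * s <= a + b)%R by rewrite lerD2l ler_piMr// ltW.
pose f c := h (0 < c)%N c.
have f01 : unitf f by move=> c; apply: h01.
rewrite (_ : (fun l => _) = fun l => bsum s l (fun u => f (count id u))); last first.
  by apply/funext => l; congr bsum; apply/funext => u; rewrite has_count.
pose rho := (b / (a + b))%R.
have rho0 : (0 <= rho)%R by rewrite divr_ge0//; lra.
have rho1 : (rho < 1)%R by rewrite ltr_pdivrMr; lra.
pose w k := (1 * rho ^+ k)%R.
have w0 : wge0 w by move=> k; rewrite /w mul1r exprn_ge0.
pose F l (g : nat -> \bar R) := bsum s l (fun u => g (count id u)).
have F01 l g : unitf g -> 0 <= F l g <= 1.
  by move=> g01; apply: bsum_unit => // u; apply: g01.
have F0 g : unitf g -> nng (fun l => F l g) by move=> g01 l; have /andP[] := F01 l g g01.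
have FS l g : F l.+1 g = (1 - s)%:E * F l g + s%:E * F l (fun k => g k.+1) by [].
have G01 g : unitf g -> unitf (fun k => g k.+1 : \bar R) by move=> g01 k; apply: g01.
pose Psi g := wsum w (fun l => F l g).
pose C := (1 / (1 - rho))%R.
have PsiC g : unitf g -> 0 <= Psi g <= C%:E.
  move=> g01; apply/andP; split; first exact: (wsum_ge0 w0 (F0 _ g01)).
  rewrite -(wsum_geometric ler01 rho0 rho1).
  apply: (le_wsum w0 (F0 _ g01)).
  by move=> l; have /andP[] := F01 l g g01.
have fin g : unitf g -> Psi g \is a fin_num.
  by move=> /PsiC/andP[P0 P1]; rewrite ge0_fin_numE// (le_lt_trans P1)// ltry.
have PsiS g : unitf g -> wsum w (fun l => F l.+1 g) =
    (1 - s)%:E * Psi g + s%:E * Psi (fun k => g k.+1).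
  move=> g01; rewrite (_ : (fun l => _) = (fun l => (1 - s)%:E * F l g + s%:E * F l (fun k => g k.+1)))//.
  have Fg0 := F0 _ g01; have Fg0' := F0 _ (G01 _ g01).
  rewrite wsumD//; [|by move=> l; apply: mule_ge0; [rewrite lee_fin subr_ge0|exact: Fg0]
    |by move=> l; apply: mule_ge0; [rewrite lee_fin ltW|exact: Fg0']].
  by rewrite !wsumZ.
have PsiE g : unitf g -> Psi g = g 0%N + rho%:E * wsum w (fun l => F l.+1 g).
  move=> g01; rewrite /Psi wsum_recl//; last exact: F0.
  rewrite /w expr0 mulr1 mul1e; congr (_ + _).
  rewrite -wsum_scale//; last by move=> l; apply: F0.
  by congr wsum; apply/funext => k; rewrite !mul1r exprS.
(* Writing g' for the shift of g, [PsiE] and [PsiS] give Psi g = g 0 + rho ((1 - s) Psi g + s Psi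
   g'). Collecting Psi g on the left produces the factor [tau], and [d] is rho s / tau. *)
pose tau := (1 - rho * (1 - s))%R.
have tauE : (tau = (a + b * s) / (a + b))%R by rewrite /tau /rho; field; lra.
have tau0 : (0 < tau)%R by rewrite tauE divr_gt0//; lra.
pose d := (b * s / (a + b * s))%R.
have d0 : (0 <= d)%R by rewrite divr_ge0//; lra.
have d1 : (d < 1)%R by rewrite ltr_pdivrMr; lra.
have Psirec g : unitf g -> Psi g = (tau^-1)%:E * g 0%N + d%:E * Psi (fun k => g k.+1).
  move=> g01; have := PsiE g g01; rewrite PsiS//.
  have := fin _ g01; have := fin _ (G01 _ g01); have := fin_unit (g01 0%N).
  move: (Psi g) (Psi _) (g 0%N) => [x| |]// [y| |]// [z| |]// _ _ _.
  rewrite -?(EFinM, EFinD) => -[xE]; congr EFin.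
  have {}xE : (tau * x = z + rho * s * y)%R by rewrite /tau; lra.
  apply: (mulfI (lt0r_neq0 tau0)); rewrite xE tauE /d /rho.
  by field; rewrite !gt_eqF//=; lra.
have q01 : (0 < a / (a + b * s) <= 1)%R.
  by rewrite divr_gt0 ?ler_pdivrMr//; lra.
have dq : (1 - a / (a + b * s) = d)%R by rewrite /d; field; lra.
have Psif := geom_functional (b := 0%N) (ltW (_ : 0 < tau^-1)%R) d0 d1 PsiC Psirec (G01 _ f01).
rewrite wsum_recl/=; [|exact: (is_LF_pLF a0 b0 ab).1|exact: (F0 _ f01)].
rewrite wsum_scale; [|by move=> k; have := w0 k; rewrite /w mul1r|by move=> l; exact: (F0 _ f01 l.+1)].
rewrite [X in _ + _ * X = _](_ : _ = wsum w (fun l => F l.+1 f)); last first.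
  by congr wsum; apply/funext => k; rewrite /w mul1r.
rewrite PsiS// Psirec//.
have -> : wsum (geomp (a / (a + b * s))) (h true) =
    ((a / (a + b * s)) * tau)%:E * Psi (fun k => f k.+1).
  rewrite wsum_geomp//; last by apply: unitf_nng.
  rewrite Psif ?invr_gt0// -wsum_scale//.
  - rewrite dq; congr wsum; apply/funext => k; last by rewrite addn0.
    by rewrite mulrA mulfK// gt_eqF.
  - by move=> k; rewrite mulr_ge0 ?exprn_ge0// invr_ge0 ltW.
  - by move=> k; apply: unitf_nng => j; apply: f01.
have := fin _ (G01 _ f01); have := fin_unit (f01 0%N).
rewrite -/(f 0%N) /=.
move: (Psi _) (f 0%N) => [x| |]// [y| |]// _ _.
rewrite -?(EFinM, EFinD); congr EFin.
rewrite tauE /d /rho; field; rewrite !gt_eqF//=; lra.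
Qed.

End Branching.

(** * The reduced process *)

Section Survival.

Definition child_survival (c : seq nat) (s : seq bool) : seq bool :=
  [seq has id (take (nth 0 c j) (drop (sumn (take j c)) s)) | j <- iota 0 (size c)].

Arguments child_survival : simpl never.

Lemma size_child_survival c s : size (child_survival c s) = size c.
Proof. by rewrite size_map size_iota. Qed.

Lemma child_survival_cons y c u v : size u = y ->
  child_survival (y :: c) (u ++ v) = has id u :: child_survival c v.
Proof.
move=> uy; rewrite /child_survival /= drop0 take_cat uy ltnn subnn take0 cats0.
congr (_ :: _); rewrite (iotaDl 1 0) -map_comp; apply: eq_map => j /=.
by rewrite drop_cat uy ltnNge leq_addr /= addKn.
Qed.

Lemma has_child_survival c s : size s = sumn c -> has id (child_survival c s) = has id s.
Proof.
elim: c s => [|y c IH] s sE; first by move/size0nil: sE ->.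
rewrite /= in sE.
 have ys : (y <= size s)%N by rewrite sE leq_addr.
have := child_survival_cons c (drop y s) (size_takel ys); rewrite cat_take_drop => ->.
by rewrite /= IH ?size_drop ?sE ?addKn// -has_cat cat_take_drop.
Qed.

(** The flags of [surv] by recursion on the forest itself, rather than on an index into a fixed
    tree. *)
Fixpoint fsurv (x : nat) (t : seq (seq nat)) : seq bool :=
  if t is l :: t' then child_survival l (fsurv (sumn l) t') else nseq x true.

Fixpoint red (x : nat) (t : seq (seq nat)) : seq nat :=
  count id (fsurv x t) :: (if t is l :: t' then red (sumn l) t' else [::]).

Fixpoint sizes (x : nat) (t : seq (seq nat)) : seq nat :=
  x :: (if t is l :: t' then sizes (sumn l) t' else [::]).

Lemma size_fsurv x t : forest x t -> size (fsurv x t) = x.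
Proof.
case: t => [|l t] /=; first by rewrite size_nseq.
by move=> [<- _]; rewrite size_child_survival.
Qed.

Lemma size_red x t : size (red x t) = (size t).+1.
Proof. by elim: t x => [//|l t IH] x /=; rewrite IH. Qed.

Lemma size_sizes x t : size (sizes x t) = (size t).+1.
Proof. by elim: t x => [//|l t IH] x /=; rewrite IH. Qed.

(** In the last generation everybody survives, so the event Z_n > 0 becomes a condition on the flags
    of the roots. *)
Lemma last_red x t : forest x t -> (0 < nth 0 (red x t) (size t))%N = has id (fsurv x t).
Proof.
elim: t x => [|l t IH] x /=; first by rewrite has_count.
move=> [lx fl]; rewrite IH// has_child_survival//; exact: size_fsurv.
Qed.

Lemma surv_fsurv t k d : size t = (k + d)%N ->
  surv t k d = fsurv (gen_size t k) (drop k t).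
Proof.
elim: d k => [|d IH] k tk; first by rewrite drop_oversize // tk addn0.
have kt : (k < size t)%N by rewrite tk -addSnnS leq_addr.
by rewrite (drop_nth [::] kt) /= IH// tk addSnnS.
Qed.

Lemma nth_red x t k : (k <= size t)%N ->
  nth 0 (red x t) k =
  count id (fsurv (if k is k'.+1 then sumn (nth [::] t k') else x) (drop k t)).
Proof.
elim: t x k => [|l t IH] x [|k]//= kt; rewrite IH//.
by case: k kt => [|k] // _; rewrite ?drop0.
Qed.

Lemma Zmn_red n t m : size t = n -> (m <= n)%N -> Zmn t m n = nth 0 (red 1 t) m.
Proof.
by move=> tn mn; rewrite nth_red ?tn// /Zmn surv_fsurv ?subnKC.
Qed.

Lemma nth_sizes x t k : (k <= size t)%N ->
  nth 0 (sizes x t) k = if k is k'.+1 then sumn (nth [::] t k') else x.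
Proof.
elim: t x k => [|l t IH] x [|k]//= kt; rewrite IH//.
by case: k kt.
Qed.

Lemma Zmn_drop_red n t m : size t = n -> (m <= n)%N ->
  [seq Zmn t (m + k) n | k <- iota 0 (n - m).+1] = drop m (red 1 t).
Proof.
move=> tn mn; apply: (@eq_from_nth _ 0).
  by rewrite size_map size_iota size_drop size_red tn subSn.
move=> i; rewrite size_map size_iota => i1.
rewrite (nth_map 0) ?size_iota// nth_iota// nth_drop (Zmn_red tn)//.
by rewrite -(subnKC mn) leq_add2l.
Qed.

End Survival.

Section Decomposition.
Variable R : realType.
Local Open Scope ereal_scope.
Implicit Types (p : nat -> R).

(** One generation of the decomposition. Instead of drawing all offspring and then the flags of the
    children, one may draw the flags of the parents and then the surviving offspring of the flagged
    ones; the others contribute no survivor. *)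
Lemma thins_child_survival p (s s' : R) r x (G : seq bool -> nat -> \bar R) :
  law p -> law r -> (0 <= s <= 1)%R -> (0 <= s' <= 1)%R ->
  thins p s s' r -> (forall v, unitf (G v)) ->
  vsum p x (fun l => bsum s (sumn l) (fun u => G (child_survival l u) (count id u))) =
  bsum s' x (fun v => vsum r (count id v) (fun c => G v (sumn c))).
Proof.
move=> lp lr s01 s01' th; elim: x G => [//|x IH] G G01 /=.
(* What the other [x] parents contribute, given the flag [b] and the number [c] of surviving
   children of the first. *)
pose H b c := bsum s' x (fun v => vsum r (count id v) (fun l => G (b :: v) (c + sumn l)%N)).
have H01 b : unitf (H b).
  by move=> c; apply: bsum_unit => // v; apply: vsum_unit => // l; apply: G01.
transitivity (wsum p (fun y => bsum s y (fun u => H (has id u) (count id u)))).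
  congr wsum; apply/funext => y.
  rewrite (_ : (fun l => _) = (fun l => bsum s y (fun u => bsum s (sumn l)
     (fun v => G (has id u :: child_survival l v) (count id u + count id v)%N)))); last first.
    apply/funext => l; rewrite bsum_cat; apply: eq_bsum => u uy.
    by congr bsum; apply/funext => v; rewrite child_survival_cons// count_cat.
  rewrite vsum_bsum//; [|exact: lp.1|by move=> l u; apply: bsum_ge0 => // v; apply: unitf_nng].
  congr bsum; apply/funext => u.
  by apply: (IH (fun v z => G (has id u :: v) (count id u + z)%N)) => v z; apply: G01.
rewrite (th H H01); congr (_ * _ + _ * _).
rewrite /H -bsum_wsum//; first exact: lr.1.
by move=> v c; apply: vsum_ge0 => [|l]; [exact: lr.1|apply: unitf_nng].
Qed.

(* [sg k] is the survival probability, to the last generation, of an individual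
   of generation [k]: the initial individuals survive independently with
   probability [sg 0], and given this the reduced sizes follow the laws [r k]. *)
Lemma fsum_decomp n (P r : nat -> nat -> R) (sg : nat -> R) x
    (H : seq bool -> seq nat -> \bar R) :
  (forall k, law (P k)) -> (forall k, law (r k)) ->
  (forall k, (0 <= sg k <= 1)%R) -> sg n = 1%R ->
  (forall k, (k < n)%N -> thins (P k) (sg k.+1) (sg k) (r k)) ->
  (forall u, unitf (H u)) ->
  fsum n P x (fun t => H (fsurv x t) (red x t)) =
  bsum (sg 0%N) x (fun u => fsum n r (count id u) (fun t => H u (sizes (count id u) t))).
Proof.
elim: n P r sg x H => [|n IH] P r sg x H lP lr s01 sn th H01 /=.
  rewrite sn; elim: x H H01 => [//|x IH] H H01 /=.
  (* A root of the last generation has flag [true]; the [1 +] in the new test function puts back its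
     contribution to the count. *)
  rewrite subrr mul0e add0e mul1e; apply: (IH (fun u s => H (true :: u) [:: (1 + head 0%N s)%N])).
  by move=> u s; apply: H01.
pose G v z := fsum n (fun k => r k.+1) z (fun t => H v (count id v :: sizes z t)).
rewrite -(@thins_child_survival (P 0%N) (sg 1%N) (sg 0%N) (r 0%N) x G)//; last 2 first.
- exact: th.
- by move=> v z; apply: fsum_unit => [k|t]; [apply: lr|apply: H01].
congr vsum; apply/funext => l.
rewrite (IH _ (fun k => r k.+1) (fun k => sg k.+1) _
  (fun u f => H (child_survival l u) (count id (child_survival l u) :: f)))//.
- by move=> k kn; apply: th.
- by move=> u f; apply: H01.
Qed.

(** The generations removed by [drop m] are summed out one at a time by [geomp_merge], each
    multiplying the initial parameter by its own. *)
Lemma fsum_geomp_collapse n m (r : nat -> nat -> R) (q : nat -> R) (q0 : R)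
    (phi : seq nat -> \bar R) :
  (m <= n)%N -> (0 < q0 <= 1)%R -> (forall k, (0 < q k <= 1)%R) ->
  (forall k, (k < m)%N -> r k = geomp (q k)) ->
  (forall k, law (r k)) -> unitf phi ->
  wsum (geomp q0) (fun x => fsum n r x (fun t => phi (drop m (sizes x t)))) =
  wsum (geomp (q0 * \prod_(k < m) q k)%R)
     (fun z => fsum (n - m) (fun k => r (m + k)%N) z (fun t => phi (sizes z t))).
Proof.
elim: m n r q q0 => [|m IH] n r q q0 mn q00 q1 rE lr phi1.
  rewrite big_ord0 mulr1 subn0; congr wsum; apply/funext => x.
  by congr fsum; apply/funext => t; rewrite drop0.
case: n mn => [//|n] mn /=.
pose f z := fsum n (fun k => r k.+1) z (fun t => phi (drop m (sizes z t))).
have f01 : unitf f by move=> z; apply: fsum_unit => // t; apply: phi1.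
transitivity (wsum (geomp q0) (fun x => vsum (geomp (q 0%N)) x (fun l => f (sumn l)))).
  by rewrite rE.
have ? : (0 < q0 * q 0%N <= 1)%R.
  have /andP[? ?] := q00; have /andP[? ?] := q1 0%N.
  by rewrite mulr_gt0//= mulr_ile1// ltW.
rewrite geomp_merge// (IH n (fun k => r k.+1) (fun k => q k.+1))//.
by rewrite big_ord_recl mulrA.
by move=> k km; apply: rE.
Qed.

End Decomposition.

Section Quenched.
Variable R : realType.
Local Open Scope ereal_scope.
Implicit Types (p : nat -> R).

Lemma law_LF (a b : R) p : is_LF a b p -> law p.
Proof.
move=> [p0 [p1 _]]; split; first exact: p0.
apply: cvg_lim => //; rewrite (_ : (fun n => _) = (fun n => (series p n)%:E)).
  by apply: cvg_EFin => //; exact: nearW.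
apply/funext => n; rewrite seriesEnat -sumEFin.
by apply: eq_bigr => i _; rewrite mule1.
Qed.

Lemma eq_fsum_laws n (P P' : nat -> nat -> R) x g :
  (forall k, (k < n)%N -> P k = P' k) -> fsum n P x g = fsum n P' x g.
Proof.
elim: n P P' x g => [//|n IH] P P' x g PP' /=.
rewrite PP'//; congr vsum; apply/funext => l.
by apply: IH => k kn; apply: PP'.
Qed.

(** Lets the laws be changed from generation [n] on. This matters for the reversed environment,
    where the index [n - k] is truncated to 0. *)
Lemma eq_qP_laws n (P P' : nat -> nat -> R) E :
  (forall k, (k < n)%N -> P k = P' k) -> qP P n E = qP P' n E.
Proof.
move=> PP'; congr fine; apply: eq_esum => t [[tn _] _]; congr EFin.
by apply: eq_bigr => k _; rewrite PP'// -tn.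
Qed.

Lemma unit_nat_of_bool (c : bool) : 0 <= (c%:R : R)%:E <= 1.
Proof. by case: c; rewrite !lee_fin ?lexx ?ler01. Qed.

Lemma eq_qprob (n : nat) (P : nat -> nat -> R) (E E' : set (seq (seq nat))) :
  (forall t, size t = n -> E t <-> E' t) -> qprob P n E = qprob P n E'.
Proof.
move=> EE'; rewrite /qprob; congr (esum _ _); apply/seteqP; split => t /= [vt Et].
  by split => //; apply/EE' => //; case: vt.
by split => //; apply/EE' => //; case: vt.
Qed.

Lemma fsum_indic_cst (n : nat) (P : nat -> nat -> R) x (c : bool) :
  (forall k, law (P k)) -> fsum n P x (fun=> (c%:R)%:E) = (c%:R)%:E.
Proof.
move=> lP; case: c; first exact: fsum_cst.
apply/eqP; rewrite eq_le; apply/andP; split; last by apply: fsum_ge0 => // k; case: (lP k).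
elim: n P x lP => [//|n IH] P x lP /=.
have v0 : vsum (P 0%N) x (fun=> 0%:E * 1) = 0.
  by rewrite vsumZ ?mul0e//; case: (lP 0%N).
rewrite -[leRHS]v0; apply: le_vsum => [|l|l].
- by case: (lP 0%N).
- by apply: fsum_ge0 => // k; case: (lP k.+1).
- by rewrite mul0e; apply: IH.
Qed.

Lemma wsum_geomp1 (f : nat -> \bar R) : nng f -> wsum (geomp 1) f = f 1%N.
Proof.
move=> f0; rewrite wsum_geompS//; last by rewrite ltr01 lexx.
by rewrite subrr mul0e adde0 mul1e.
Qed.

Section environment.
Variables (n : nat) (P : nat -> nat -> R) (a b u : nat -> R).
Hypothesis a0 : forall k, (0 < a k)%R.
Hypothesis b0 : forall k, (0 < b k)%R.
Hypothesis ab1 : forall k, (1 <= a k + b k)%R.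
Hypothesis PLF : forall k, is_LF (a k) (b k) (P k).
Hypothesis un : forall k, (n <= k)%N -> u k = 1%R.
Hypothesis urec : forall k, (k < n)%N -> (u k = a k * u k.+1 + b k)%R.

(** Backward induction from [n]: u_{k+1} >= 1 gives a_k u_{k+1} + b_k >= a_k + b_k >= 1. Hence 1 /
    u_k is a probability. *)
Lemma env_u_ge1 k : (1 <= u k)%R.
Proof.
have [nk|kn] := leqP n k; first by rewrite un.
rewrite -(subKn (ltnW kn)); elim: (n - k)%N (leq_subr k n) => [_|d IH dn].
  by rewrite subn0 un.
rewrite urec; last by rewrite ltn_subrL (leq_trans _ dn).
have {}IH := IH (ltnW dn).
have -> : ((n - d.+1).+1 = n - d)%N by rewrite -subSn.
by apply: le_trans (ab1 (n - d.+1)%N) _; rewrite lerD2r ler_peMr// ltW.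
Qed.

Let u_gt0 k : (0 < u k)%R. Proof. exact: lt_le_trans (env_u_ge1 k). Qed.

(** The parameter a_k u_{k+1} / u_k, in a form that lies in (0, 1] also for [k >= n], where [u] does
    not follow the recursion. *)
Definition env_q k : R := (a k / (a k + b k * (u k.+1)^-1))%R.

Lemma env_q01 k : (0 < env_q k <= 1)%R.
Proof.
have ? : (0 < b k * (u k.+1)^-1)%R by rewrite mulr_gt0// invr_gt0.
by rewrite /env_q divr_gt0 ?ler_pdivrMr ?addr_gt0//= mul1r lerDl ltW.
Qed.

Lemma env_qE k : (k < n)%N -> env_q k = (a k * u k.+1 / u k)%R.
Proof.
move=> kn; rewrite (urec kn) /env_q; have := u_gt0 k.+1; have := u_gt0 k.
rewrite (urec kn) => uk uk1.
have : (0 < b k * (u k.+1)^-1)%R by rewrite mulr_gt0// invr_gt0.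
move=> buk; field; rewrite !gt_eqF//.
Qed.

Lemma env_prod_q m : (m <= n)%N ->
  (\prod_(k < m) env_q k = (\prod_(k < m) a k) * u m / u 0%N)%R.
Proof.
elim: m => [_|m IH mn]; first by rewrite !big_ord0 mul1r divff// gt_eqF.
rewrite !big_ord_recr/= IH ?(ltnW mn)// env_qE//.
have := u_gt0 m; have := u_gt0 0; move=> ? ?; field.
by rewrite !gt_eqF.
Qed.

Lemma env_decomp x (H : seq bool -> seq nat -> \bar R) : (forall v, unitf (H v)) ->
  fsum n P x (fun t => H (fsurv x t) (red x t)) =
  bsum (u 0%N)^-1 x (fun v => fsum n (fun k => geomp (env_q k)) (count id v)
     (fun t => H v (sizes (count id v) t))).
Proof.
move=> H01; apply: (fsum_decomp (sg := fun k => (u k)^-1)%R) => //.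
- by move=> k; exact: law_LF (PLF k).
- by move=> k; apply: law_geomp; exact: env_q01.
- by move=> k; rewrite invr_ge0 ltW//= invf_le1// env_u_ge1.
- by rewrite un// invr1.
- move=> k kn; have -> : (u k)^-1%R = ((u k.+1)^-1 / (a k + b k * (u k.+1)^-1))%R.
    rewrite (urec kn); have := u_gt0 k.+1; have := u_gt0 k; rewrite (urec kn) => uk uk1.
    have : (0 < b k * (u k.+1)^-1)%R by rewrite mulr_gt0// invr_gt0.
    by move=> buk; field; rewrite !gt_eqF.
  apply: thins_LF => //; rewrite invr_gt0 u_gt0/= invf_le1//; exact: env_u_ge1.
Qed.

Lemma quenched_reduced m (S : set (seq nat)) : (m <= n)%N ->
  qP_surv P n [set t | S [seq Zmn t (m + k)%N n | k <- iota 0 (n - m).+1]] =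
  fine (wsum (geomp (\prod_(k < m) env_q k))
    (fun z => fsum (n - m) (fun k => geomp (env_q (m + k)%N)) z
                (fun t => (\1_S (sizes z t))%:E))).
Proof.
move=> mn.
have P0 k : wge0 (P k) by case: (PLF k).
have lq k : law (geomp (env_q k)) by apply: law_geomp; exact: env_q01.
have u0 : (0 < (u 0%N)^-1)%R by rewrite invr_gt0.
(* For one root only the branch with flag [true] contributes, with weight 1 / u_0. Taking [T] to be
   [S] and then [setT] gives numerator and denominator of the conditional probability, and the
   weight cancels. *)
have E1 (T : set (seq nat)) : qprob P n ([set t | T (drop m (red 1 t))] `&`
    [set t | (0 < Zmn t n n)%N]) =
    (u 0%N)^-1%:E * fsum n (fun k => geomp (env_q k)) 1 (fun t => (\1_T (drop m (sizes 1 t)))%:E).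
  rewrite qprob_fsum//.
  rewrite (@eq_fsum _ _ _ _ _ (fun t => ((has id (fsurv 1 t) && (drop m (red 1 t) \in T))%:R)%:E)); last first.
    move=> t tn ft; rewrite indicE; congr ((nat_of_bool _)%:R)%:E.
    rewrite -(last_red ft) tn -(Zmn_red tn)// andbC.
    apply/idP/idP => [/set_mem[/= /mem_set -> ->]//|/andP[/set_mem ? ?]].
    by apply/mem_set; split.
  rewrite (@env_decomp 1 (fun v f => ((has id v && (drop m f \in T))%:R)%:E)); last first.
    by move=> v f; exact: unit_nat_of_bool.
  rewrite /= (fsum_indic_cst n _ false lq) mule0 add0e.
  by congr (_ * fsum _ _ _ _); apply/funext => t; rewrite indicE.
have -> : qP_surv P n [set t | S [seq Zmn t (m + k)%N n | k <- iota 0 (n - m).+1]] =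
    (fine (qprob P n ([set t | S (drop m (red 1 t))] `&` [set t | (0 < Zmn t n n)%N])) /
    fine (qprob P n ([set t | setT (drop m (red 1 t))] `&` [set t | (0 < Zmn t n n)%N])))%R.
  rewrite /qP_surv /qP; congr (fine _ / fine _)%R; apply: eq_qprob => t tn /=.
    by rewrite -(Zmn_drop_red tn).
  by split => [|[]].
rewrite !E1 (_ : (fun t => (\1_setT _)%:E) = fun=> (true%:R)%:E); last first.
  by apply/funext => t; rewrite indicT.
have Sx (T : set (seq nat)) f : unitf (fun t => (\1_T (f t : seq nat))%:E : \bar R).
  by move=> t; rewrite indicE; exact: unit_nat_of_bool.
rewrite (fsum_indic_cst _ _ true lq) (_ : (true%:R)%:E = 1 :> \bar R)// mule1.
(* A single root is an initial law [geomp 1], so the collapse can start from [q0 = 1]. *)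
have := fsum_geomp_collapse (r := fun k => geomp (env_q k)) (q0 := 1%R) (q := env_q)
  (phi := fun f => (\1_S f)%:E) mn.
rewrite ltr01 lexx mul1r => /(_ isT env_q01 (fun _ _ => erefl) lq (Sx _ S id)) <-.
rewrite wsum_geomp1; last first.
  by move=> x; have /andP[] := fsum_unit n x lq (Sx _ S (fun t => drop m (sizes x t))).
have /fin_unit := fsum_unit n 1 lq (Sx _ S (fun t => drop m (sizes 1 t))).
move: (fsum _ _ _ _) => [x| |]// _.
by rewrite -EFinM /= mulrAC divff ?mul1r// gt_eqF.
Qed.

Lemma quenched_gt1 m : (m <= n)%N ->
  qP_surv P n [set t | (1 < Zmn t m n)%N] =
  (1 - (\prod_(k < m) a k) * u m / u 0%N)%R.
Proof.
move=> mn; rewrite -(env_prod_q mn).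
have -> : [set t | (1 < Zmn t m n)%N] = [set t | [set s | (1 < head 0 s)%N]
    [seq Zmn t (m + k)%N n | k <- iota 0 (n - m).+1]].
  by apply/seteqP; split => t /=; rewrite addn0.
rewrite quenched_reduced//.
set Q := (\prod_(k < m) env_q k)%R.
have Q01 : (0 < Q <= 1)%R.
  rewrite prodr_gt0; last by move=> k _; case/andP: (env_q01 k).
  by apply: prodr_ile1 => k _; case/andP: (env_q01 k) => /ltW -> ->.
rewrite (_ : (fun z => _) = fun z => ((1 < z)%N%:R)%:E); last first.
  apply/funext => z; rewrite -[RHS](fsum_indic_cst (n - m) (P := fun k => geomp (env_q (m + k)%N)) z); last first.
    by move=> k; apply: law_geomp; exact: env_q01.
  congr fsum; apply/funext => t; rewrite indicE; congr ((nat_of_bool _)%:R)%:E.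
  case: t => [|l t]; apply/idP/idP => [/set_mem//|h]; exact/mem_set.
rewrite wsum_geompS//=.
rewrite mule0 add0e wsum_geomp//.
have [_] := law_geomp Q01; rewrite wsum_geomp//.
rewrite (_ : cst 1 = fun k => ((1 < k.+2)%N%:R)%:E)//.
by move=> ->; rewrite mule1.
Qed.

End environment.
End Quenched.

(** * Comparison of two geometric laws *)

Section TotalVariation.
Variable R : realType.
Local Open Scope ereal_scope.

(** Splitting off the value 1 bounds the difference by |Q - q| plus (1 - q) times the difference for
    the shifted function, an affine recursion with fixed point |Q - q| / q. The function changes at
    each step, so the recursion is run [N] times from the trivial bound 1, with error (1 - q)^N. *)
Lemma geomp_tv (Q q : R) (W : nat -> \bar R) : (0 < Q <= 1)%R -> (0 < q <= 1)%R ->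
  unitf W -> (`|fine (wsum (geomp Q) W) - fine (wsum (geomp q) W)| <= `|Q - q| / q)%R.
Proof.
move=> Q01 q01; have lQ := law_geomp Q01; have lq := law_geomp q01.
have /andP[q0 q1] := q01.
have bound N V : unitf V ->
    (`|fine (wsum (geomp Q) V) - fine (wsum (geomp q) V)| <=
     `|Q - q| / q + (1 - q) ^+ N)%R.
  elim: N V => [|N IH] V V01.
    have /andP[x0 x1] := wsum_unit lQ V01; have /andP[y0 y1] := wsum_unit lq V01.
    move: x0 x1 y0 y1; case: (wsum _ _) (wsum _ _) => [x| |] [y| |]//.
    rewrite !lee_fin expr0 /= => x0 x1 y0 y1.
    have : (0 <= `|Q - q| / q)%R by rewrite divr_ge0// ltW.
    by move=> ?; rewrite ler_norml; lra.
  have V01' : unitf (fun k => V k.+1) by move=> k; apply: V01.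
  have := IH _ V01'.
  rewrite (wsum_geompS Q01 (unitf_nng V01)) (wsum_geompS q01 (unitf_nng V01)).
  have /andP[x0 x1] := wsum_unit lQ V01'; have /andP[y0 y1] := wsum_unit lq V01'.
  have /andP[z0 z1] := V01 1%N.
  move: x0 x1 y0 y1 z0 z1; move: (wsum _ _) (wsum _ _) (V 1%N) => [y| |] [x| |] [z| |]//.
  rewrite !lee_fin -?(EFinM, EFinD) /= => x0 x1 y0 y1 z0 z1 {}IH.
  have -> : (Q * z + (1 - Q) * x - (q * z + (1 - q) * y) =
    (Q - q) * (z - x) + (1 - q) * (x - y))%R by ring.
  apply: le_trans (ler_normD _ _) _; rewrite !normrM.
  have -> : (`|Q - q| / q + (1 - q) ^+ N.+1 =
    `|Q - q| + (1 - q) * (`|Q - q| / q + (1 - q) ^+ N))%R.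
    by rewrite exprS; field; rewrite gt_eqF.
  apply: lerD; first by rewrite ler_piMr// ler_norml; lra.
  by rewrite (ger0_norm (_ : 0 <= 1 - q)%R) ?subr_ge0// ler_wpM2l// subr_ge0.
move=> W01; apply/ler_addgt0Pr => e e0.
have /cvgrPdist_le/(_ e e0) : geometric 1%R (1 - q)%R @ \oo --> (0%R : R).
  by apply: cvg_geometric; rewrite ger0_norm ?subr_ge0//; lra.
move=> [N _ /(_ N (leqnn N))] /=; rewrite sub0r normrN mul1r => h.
apply: le_trans (bound N _ W01) _; rewrite lerD2l.
by apply: le_trans h; exact: ler_norm.
Qed.

End TotalVariation.

(** * Explicit survival probabilities in the forward and the reversed environment *)

Section Environment.
Variables (R : realType) (lf : R -> R -> nat -> R) (A B : nat -> R).
Hypothesis lfP : forall a b, 0 < a -> 0 < b -> 1 <= a + b -> is_LF a b (lf a b).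
Hypothesis envP : forall k, (0 < k)%N -> 0 < A k /\ 0 < B k /\ 1 <= A k + B k.

Lemma PiS n : Pi A n.+1 = Pi A n * A n.+1.
Proof. by rewrite /Pi big_nat_recr. Qed.

Lemma Pi0 : Pi A 0 = 1.
Proof. by rewrite /Pi big_nil. Qed.

Lemma Pi_gt0 n : 0 < Pi A n.
Proof.
elim: n => [|n IH]; first by rewrite Pi0.
by rewrite PiS mulr_gt0//; case: (envP (ltn0Sn n)).
Qed.

Lemma RnS n : Rn A B n.+1 = Rn A B n + Pi A n * B n.+1.
Proof. by rewrite /Rn big_nat_recr. Qed.

Lemma Rn0 : Rn A B 0 = 0.
Proof. by rewrite /Rn big_nil. Qed.

Lemma RinvS n : Rinv A B n.+1 = Rinv A B n + (Pi A n.+1)^-1 * B n.+1.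
Proof. by rewrite /Rinv big_nat_recr. Qed.

Lemma Rinv0 : Rinv A B 0 = 0.
Proof. by rewrite /Rinv big_nil. Qed.

Lemma Rinv_lt n : Rinv A B n < Rinv A B n.+1.
Proof.
rewrite RinvS ltrDl mulr_gt0 ?invr_gt0 ?Pi_gt0//.
by case: (envP (ltn0Sn n)) => _ [].
Qed.

Lemma Rinv_nd : {homo Rinv A B : m n / (m <= n)%N >-> m <= n}.
Proof. by apply/nondecreasing_seqP => n; rewrite ltW// Rinv_lt. Qed.

Lemma Rinv_ge0 n : 0 <= Rinv A B n.
Proof. by rewrite -Rinv0 Rinv_nd. Qed.

Lemma Rn_lt n : Rn A B n < Rn A B n.+1.
Proof.
rewrite RnS ltrDl mulr_gt0 ?Pi_gt0//; by case: (envP (ltn0Sn n)) => _ [].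
Qed.

Lemma Rn_nd : {homo Rn A B : m n / (m <= n)%N >-> m <= n}.
Proof. by apply/nondecreasing_seqP => n; rewrite ltW// Rn_lt. Qed.

Lemma Rn_ge0 n : 0 <= Rn A B n.
Proof. by rewrite -Rn0 Rn_nd. Qed.

Let prod_pi m : \prod_(k < m) A k.+1 = Pi A m.
Proof. by rewrite /Pi big_add1 /= big_mkord. Qed.

Lemma fwd_gt1 m n : (m <= n)%N ->
  qP_surv (env_fwd lf A B n) n [set t | (1 < Zmn t m n)%N] =
  Rn A B m / (Pi A n + Rn A B n).
Proof.
move=> mn.
(* The solution of u_k = A_{k+1} u_{k+1} + B_{k+1} with u_n = 1, continued by 1 beyond [n]. *)
pose u k := if (k < n)%N then (Pi A n + Rn A B n - Rn A B k) / Pi A k else 1.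
have uE k : (k <= n)%N -> u k = (Pi A n + Rn A B n - Rn A B k) / Pi A k.
  rewrite /u; case: ltngtP => // -> _; rewrite addrK divff// gt_eqF//; exact: Pi_gt0.
rewrite (@quenched_gt1 _ n _ (fun k => A k.+1) (fun k => B k.+1) u)//.
- rewrite prod_pi !uE// Pi0 Rn0 subr0 divr1.
  have := Pi_gt0 m; have := Pi_gt0 n; have := Rn_ge0 n => ? ? ?.
  by field; rewrite !gt_eqF//=; lra.
- by move=> k; case: (envP (ltn0Sn k)).
- by move=> k; case: (envP (ltn0Sn k)) => _ [].
- by move=> k; case: (envP (ltn0Sn k)) => _ [].
- by move=> k; have [? []] := envP (ltn0Sn k); exact: lfP.
- by move=> k nk; rewrite /u ltnNge nk.
- move=> k kn; rewrite !uE//; last exact: ltnW.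
  rewrite PiS RnS; have := Pi_gt0 k; have [? _] := envP (ltn0Sn k) => ?.
  by field; rewrite !gt_eqF.
Qed.

(** Index 0 of the environment is unconstrained, yet [env_rev] reads it for generations from [n] on;
    the value 1 makes the constraints hold at every index. *)
Let A' k := if k == 0%N then 1 else A k.
Let B' k := if k == 0%N then 1 else B k.
Let envP' k : 0 < A' k /\ 0 < B' k /\ 1 <= A' k + B' k.
Proof.
rewrite /A' /B'; case: k => [|k] /=; last exact: envP.
by rewrite ltr01; split => //; split => //; lra.
Qed.

(** Inverse survival probability over the last [j] generations of the reversed environment. It
    involves e_1, ..., e_j only and not [n], which is why almost sure limits exist there. *)
Let uu j := Pi A j * (1 + Rinv A B j).

Let uuS j : uu j.+1 = A j.+1 * uu j + B j.+1.
Proof.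
rewrite /uu RinvS PiS; have := Pi_gt0 j; have [? _] := envP (ltn0Sn j) => ?.
by field; rewrite !gt_eqF.
Qed.

Let rev_surv n E : qP_surv (env_rev lf A B n) n E =
  qP_surv (fun k => lf (A' (n - k)%N) (B' (n - k)%N)) n E.
Proof.
have eq k : (k < n)%N -> env_rev lf A B n k = lf (A' (n - k)%N) (B' (n - k)%N).
  by rewrite -subn_gt0 => kn; rewrite /env_rev /A' /B' gtn_eqF.
by rewrite /qP_surv !(eq_qP_laws _ eq).
Qed.

Section rev.
Variable n : nat.
Let a k := A' (n - k)%N.
Let b k := B' (n - k)%N.
Let u k := uu (n - k).

Let un k : (n <= k)%N -> u k = 1.
Proof.
by rewrite -subn_eq0 => /eqP; rewrite /u => ->; rewrite /uu Pi0 Rinv0 addr0 mulr1.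
Qed.

Let urec k : (k < n)%N -> u k = a k * u k.+1 + b k.
Proof.
move=> kn; rewrite /u /a /b subnS.
have : (0 < n - k)%N by rewrite subn_gt0.
by case: (n - k)%N => // j _; rewrite uuS.
Qed.

Let a0 k : 0 < a k. Proof. by case: (envP' (n - k)%N). Qed.
Let b0 k : 0 < b k. Proof. by case: (envP' (n - k)%N) => _ []. Qed.
Let ab1 k : 1 <= a k + b k. Proof. by case: (envP' (n - k)%N) => _ []. Qed.
Let LFk k : is_LF (a k) (b k) (lf (a k) (b k)). Proof. exact: lfP. Qed.

Let proda m : (m <= n)%N -> \prod_(k < m) a k = Pi A n / Pi A (n - m).
Proof.
elim: m => [_|m IH mn]; first by rewrite big_ord0 subn0 divff// gt_eqF// Pi_gt0.
rewrite big_ord_recr/= IH ?(ltnW mn)// /a subnS.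
have : (0 < n - m)%N by rewrite subn_gt0.
case: (n - m)%N => // j _; rewrite PiS /A' /=.
have := Pi_gt0 j; have [? _] := envP (ltn0Sn j) => ?.
by field; rewrite !gt_eqF.
Qed.

Lemma rev_gt1 m : (m <= n)%N ->
  qP_surv (env_rev lf A B n) n [set t | (1 < Zmn t m n)%N] =
  (Rinv A B n - Rinv A B (n - m)) / (1 + Rinv A B n).
Proof.
move=> mn; rewrite rev_surv (@quenched_gt1 _ n _ a b u)// proda// /u subn0 /uu.
have := Pi_gt0 n; have := Pi_gt0 (n - m)%N; have := Rinv_ge0 n => ? ? ?.
by field; rewrite !gt_eqF//=; lra.
Qed.

Hypothesis cvR : cvgn (Rinv A B).

Lemma Rinv_le_inf k : Rinv A B k <= Rinv_inf A B.
Proof. exact: nondecreasing_cvgn_le Rinv_nd cvR k. Qed.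

Lemma rev_tv m : (m <= n)%N ->
  (tv (reduced_law lf A B m n) (star_law A B m) <=
  (`|(1 + Rinv A B m) / (1 + Rinv A B n) - (1 + Rinv A B m) / (1 + Rinv_inf A B)| /
     ((1 + Rinv A B m) / (1 + Rinv_inf A B)))%:E)%E.
Proof.
move=> mn; have R0 := Rinv_ge0.
set Q := (_ / (1 + Rinv A B n))%R; set q := (_ / (1 + Rinv_inf A B))%R.
have ratio k l : (k <= l)%N -> (0 < (1 + Rinv A B k) / (1 + Rinv A B l) <= 1)%R.
  move=> kl; have := R0 k; have := R0 l; have := Rinv_nd kl => ? ? ?.
  by rewrite divr_gt0 ?ler_pdivrMr//; lra.
have Q01 : 0 < Q <= 1 by exact: ratio.
have q01 : 0 < q <= 1.
  have := R0 m; have := Rinv_le_inf m => ? ?.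
  by rewrite divr_gt0 ?ler_pdivrMr//; lra.
have lstar k : law (star_laws A B m k).
  case: k => [|k]; first exact: law_geomp.
  by apply: law_geomp; apply: ratio; rewrite leq_sub2l.
apply: ub_ereal_sup => _ [S _ <-]; rewrite lee_fin.
(* Probability of [S] when the last [m] generations start from [z] individuals. It is the same for
   both processes, which leaves only the initial parameters [Q] and [q] to compare. *)
pose W z := fsum m (fun k => star_laws A B m k.+1) z (fun t => (\1_S (sizes z t))%:E).
have W01 : unitf W.
  move=> z; apply: fsum_unit => // t; rewrite indicE; exact: unit_nat_of_bool.
suff [-> ->] : reduced_law lf A B m n S = fine (wsum (geomp Q) W) /\
    star_law A B m S = fine (wsum (geomp q) W) by exact: geomp_tv.
split.
  rewrite /reduced_law rev_surv.
  have := @quenched_reduced _ n _ a b u a0 b0 ab1 LFk un urec (n - m)%N S (leq_subr _ _).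
  rewrite subKn// => ->.
  rewrite (env_prod_q a0 b0 ab1 un urec) ?leq_subr// proda ?leq_subr// subKn//.
  have -> : Pi A n / Pi A m * u (n - m) / u 0 = Q.
    rewrite /u subn0 subKn// /uu /Q.
    have := Pi_gt0 n; have := Pi_gt0 m; have := R0 n => ? ? ?.
    by field; rewrite !gt_eqF//=; lra.
  congr (fine (wsum _ _)); apply/funext => z; apply: eq_fsum_laws => k km.
  rewrite (env_qE a0 b0 ab1 un urec); last first.
    by rewrite -ltn_subRL subKn.
  rewrite /star_laws /u /a; have -> : (n - (n - m + k) = m - k)%N.
    by rewrite subnDA subKn.
  have -> : (n - (n - m + k).+1 = (m - k.+1))%N.
    by rewrite -addnS subnDA subKn.
  rewrite subnS; have : (0 < m - k)%N by rewrite subn_gt0.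
  case: (m - k)%N => // j _ /=; congr geomp; rewrite /uu /A' /= PiS.
  have := Pi_gt0 j; have [? _] := envP (ltn0Sn j); have := R0 j.+1 => ? ?.
  by field; rewrite !gt_eqF//=; lra.
rewrite /star_law /qP qprob_fsum; last by move=> k; case: (lstar k).
rewrite (@eq_fsum _ _ _ _ _ (fun t => (\1_S (behead (sizes 1 t)))%:E)); last first.
  move=> t tm ft; rewrite !indicE; congr ((nat_of_bool _)%:R)%:E.
  have -> : behead (sizes 1 t) = [seq gen_size t k.+1 | k <- iota 0 m.+1].
    apply: (@eq_from_nth _ 0%N).
      by rewrite size_behead size_sizes size_map size_iota tm.
    move=> i; rewrite size_behead size_sizes tm => im.
    rewrite nth_behead nth_sizes ?tm// (nth_map 0%N) ?size_iota//.
    by rewrite nth_iota.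
  by apply/idP/idP => /set_mem h; exact/mem_set.
rewrite /= -/(star_laws A B m).
congr (fine (wsum _ _)); apply/funext => y; rewrite addn0 /W.
by [].
Qed.

End rev.

End Environment.

(** * Exchangeability of the environment *)

Section Exchangeability.
Context {R : realType} {d : measure_display} {Omega : measurableType d}.
Variables (P : probability Omega R) (A B : nat -> Omega -> R).
Hypothesis iid : iid_env P A B.
Local Open Scope ereal_scope.

(** A pi-system generating the product sigma-algebra on environments, so that equality of laws need
    only be checked on it. *)
Definition cylinder : set (set (nat -> R * R)) :=
  [set C | exists (I : seq nat) (D : nat -> set (R * R)),
    (forall k, measurable (D k)) /\ C = \bigcap_(k in [set` I]) [set x | D k (x k)]].

Local Notation path_space := (g_sigma_algebraType cylinder).

Lemma cylinderI : setI_closed cylinder.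
Proof.
move=> _ _ [I1 [D1 [mD1 ->]]] [I2 [D2 [mD2 ->]]].
exists (I1 ++ I2), (fun k => (if k \in I1 then D1 k else setT) `&`
  (if k \in I2 then D2 k else setT)); split.
  by move=> k; apply: measurableI; case: ifP.
apply/seteqP; split=> x /=.
  move=> [h1 h2] k /=; rewrite mem_cat => kI; split.
    by case: ifPn => // k1; apply: h1.
  by case: ifPn => // k2; apply: h2.
move=> h; split=> k /= kI.
  by have := h k; rewrite /= mem_cat kI => /(_ isT)[].
by have := h k; rewrite /= mem_cat kI orbT => /(_ isT)[].
Qed.

Lemma measurable_coord k : measurable_fun setT (fun x : path_space => x k : R * R).
Proof.
move=> _ Y mY; rewrite setTI; apply: sub_sigma_algebra.
exists [:: k], (fun=> Y); split => //; apply/seteqP; split => x /= h.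
  by move=> j /=; rewrite inE => /eqP ->.
by apply: (h k) => /=; rewrite inE.
Qed.

Definition env_path (s : nat -> nat) (w : Omega) : path_space :=
  fun k => env_pair A B (s k) w.

Lemma measurable_env_pair k : (0 < k)%N -> measurable_fun setT (env_pair A B k).
Proof.
by move=> k0; have [/(_ k k0)[mA mB] _] := iid; exact/measurable_fun_pair.
Qed.

Lemma measurable_env_path s : (forall k, (0 < s k)%N) ->
  measurable_fun setT (env_path s).
Proof.
move=> s0; apply: (@measurability _ _ Omega path_space setT (env_path s) cylinder erefl).
move=> _ [_ [I [D [mD ->]]] <-]; rewrite setTI.
rewrite (_ : _ @^-1` _ = \bigcap_(k in [set` I]) (env_pair A B (s k) @^-1` D k))//.
apply: fin_bigcap_measurable; first exact: finite_seq.
by move=> k _; rewrite -[X in measurable X]setTI; exact: measurable_env_pair.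
Qed.

Lemma env_path_cylinder s (I : seq nat) (D : nat -> set (R * R)) :
  (forall k, (0 < s k)%N) -> injective s -> (forall k, measurable (D k)) ->
  P (env_path s @^-1` (\bigcap_(k in [set` I]) [set x | D k (x k)])) =
  \prod_(k <- undup I) P (env_pair A B 1 @^-1` D k).
Proof.
move=> s0 sI mD; have [_ [idd ind]] := iid.
(* [g] inverts [s] on these indices; duplicates are removed because [iid_env] states independence
   for lists without repetition. *)
pose I' := undup I; pose g j := nth 0%N I' (index j (map s I')).
have gs k : k \in I' -> g (s k) = k by move=> kI; rewrite /g index_map// nth_index.
have uI : uniq (map s I') by rewrite map_inj_uniq// undup_uniq.
have -> : env_path s @^-1` (\bigcap_(k in [set` I]) [set x | D k (x k)]) =
    \bigcap_(k in [set` map s I']) (env_pair A B k @^-1` D (g k)).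
  apply/seteqP; split => w /= h k /=.
    move=> /mapP[j jI ->]; rewrite /= gs//; apply: (h j).
    by rewrite /= -mem_undup.
  move=> kI; have := h (s k); rewrite /= gs; last by rewrite mem_undup.
  by apply; apply/mapP; exists k => //; rewrite mem_undup.
rewrite ind//; first last.
  by apply/allP => _ /mapP[j _ ->]; exact: s0.
rewrite big_map -/I' !big_seq; apply: eq_bigr => k kI.
by rewrite gs// idd.
Qed.

(** Stated for arbitrary injections, so as to cover both the reversal of the first [n] indices and
    the shifts of all of them. *)
Lemma env_path_law s t (E : set path_space) :
  (forall k, (0 < s k)%N) -> injective s -> (forall k, (0 < t k)%N) -> injective t ->
  measurable E -> P (env_path s @^-1` E) = P (env_path t @^-1` E).
Proof.
move=> s0 sI t0 tI mE.
have ms := measurable_env_path s0; have mt := measurable_env_path t0.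
pose is_s := isMeasurableFun.Build _ _ _ _ _ ms.
pose is_t := isMeasurableFun.Build _ _ _ _ _ mt.
pose fs : {mfun _ >-> _} := HB.pack (env_path s) is_s.
pose ft : {mfun _ >-> _} := HB.pack (env_path t) is_t.
apply: (@measure_unique _ R path_space cylinder (fun=> setT) erefl cylinderI _ _
  (pushforward P fs) (pushforward P ft)) => //.
- move=> _; exists [::], (fun=> setT); split => //.
  by apply/seteqP; split.
- by rewrite bigcup_const.
- move=> _ [I [D [mD ->]]].
  exact: (etrans (env_path_cylinder I s0 sI mD) (esym (env_path_cylinder I t0 tI mD))).
- by have : P setT < +oo by rewrite probability_setT ltry.
Qed.

Lemma integral_env_path s t (F : path_space -> \bar R) :
  (forall k, (0 < s k)%N) -> injective s -> (forall k, (0 < t k)%N) -> injective t ->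
  measurable_fun setT F -> (forall x, 0 <= F x) ->
  \int[P]_w F (env_path s w) = \int[P]_w F (env_path t w).
Proof.
move=> s0 sI t0 tI mF F0.
have ms := measurable_env_path s0; have mt := measurable_env_path t0.
have := ge0_integral_pushforward ms P measurableT mF (fun x _ => F0 x).
rewrite preimage_setT => <-.
have := ge0_integral_pushforward mt P measurableT mF (fun x _ => F0 x).
rewrite preimage_setT => <-.
apply: eq_measure_integral => E mE _; exact: env_path_law.
Qed.

End Exchangeability.

Section NonmeasurableIntegral.
Context {R : realType} {d : measure_display} {T : measurableType d}.
Variable mu : {measure set T -> \bar R}.
Local Open Scope ereal_scope.
Import HBNNSimple.

(** The integral of a nonnegative [f] is a supremum over simple functions below [f], whether or not
    [f] is measurable; each of them is almost everywhere at most [g]. *)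
Lemma ae_le_integral_ge0 (f g : T -> \bar R) : (forall x, 0 <= f x) ->
  (forall x, 0 <= g x) -> measurable_fun setT g ->
  {ae mu, forall x, f x <= g x} -> \int[mu]_x f x <= \int[mu]_x g x.
Proof.
move=> f0 g0 mg fg; rewrite ge0_integralTE//.
apply: ub_ereal_sup => _ [h /= hf <-].
have := integral_nnsfun mu measurableT h; rewrite patch_setT => <-.
apply: ae_ge0_le_integral => //.
- by move=> x _; rewrite lee_fin.
- by apply/measurable_EFinP.
- by apply: filterS fg => x fx _; exact: le_trans (hf x) fx.
Qed.

(* [f] need not be measurable: the quenched probabilities are given by a
   measurable expression only almost surely, and [lf] is arbitrary elsewhere. *)
Lemma ae_integral_bounds (f g : T -> \bar R) :
  (forall x, 0 <= g x) -> measurable_fun setT g ->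
  {ae mu, forall x, f x = g x} -> 0 <= \int[mu]_x f x <= \int[mu]_x g x.
Proof.
move=> g0 mg fg.
have fp : \int[mu]_x f^\+ x <= \int[mu]_x g x.
  apply: ae_le_integral_ge0 => //.
  by apply: filterS fg => x fx; rewrite funeposE fx max_l.
have fn : \int[mu]_x f^\- x = 0.
  apply/eqP; rewrite eq_le integral_ge0// andbT -[leRHS](integral0 mu setT).
  apply: ae_le_integral_ge0 => //.
  by apply: filterS fg => x fx; rewrite funenegE fx max_r// oppe_le0.
by rewrite integralE fn sube0 fp integral_ge0.
Qed.

End NonmeasurableIntegral.

(** * Almost sure constraints on the environment and measurability of its functionals *)

Section RandomEnvironment.
Context {R : realType} {d : measure_display} {Omega : measurableType d}.
Variables (P : probability Omega R) (A B : nat -> Omega -> R).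
Hypothesis iid : iid_env P A B.
Hypothesis AB1 : forall k, (0 < k)%N ->
  P [set w | 0 < A k w /\ 0 < B k w /\ 1 <= A k w + B k w] = 1%E.

Definition env_ok (a b : nat -> R) :=
  forall k, (0 < k)%N -> 0 < a k /\ 0 < b k /\ 1 <= a k + b k.

Lemma measurable_A k : (0 < k)%N -> measurable_fun setT (A k).
Proof. by move=> k0; have [/(_ k k0)[]] := iid. Qed.

Lemma measurable_B k : (0 < k)%N -> measurable_fun setT (B k).
Proof. by move=> k0; have [/(_ k k0)[]] := iid. Qed.

Lemma ae_env_ok : {ae P, forall w, env_ok (A^~ w) (B^~ w)}.
Proof.
apply/ae_foralln => k; have [->|k0] := posnP k; first by apply: aeW.
pose E := [set w | 0 < A k w /\ 0 < B k w /\ 1 <= A k w + B k w].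
have mE : measurable E.
  rewrite (_ : E = (A k @^-1` `]0, +oo[) `&` ((B k @^-1` `]0, +oo[) `&`
     ((fun w => A k w + B k w) @^-1` `[1, +oo[))).
    have mp (f : Omega -> R) i : measurable_fun setT f -> measurable (f @^-1` [set` Interval (BSide i.1 i.2) +oo%O]).
      by move=> mf; rewrite -[X in measurable X]setTI; apply: mf.
    have ? := measurable_A k0; have ? := measurable_B k0.
    by apply: measurableI; [exact: (mp _ (false, 0))|apply: measurableI;
      [exact: (mp _ (false, 0))|apply: (mp _ (true, 1)); exact: measurable_funD]].
  by apply/seteqP; split => w /=; rewrite !in_itv/= !andbT.
exists (~` E); split.
- exact: measurableC.
- by apply: (etrans (probability_setC P mE)); rewrite AB1// subee.
- by move=> w /= h Ew; apply: h => _.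
Qed.

End RandomEnvironment.

(** As x^-1 = x (x^2)^-1, also at 0, the claim reduces to real powers of a nonnegative base. *)
Lemma measurable_invr {R : realType} : measurable_fun setT (@GRing.inv R).
Proof.
rewrite (_ : GRing.inv = fun x : R => x * (x ^+ 2) `^ (-1)).
  apply: measurable_funM => //.
  apply: (measurableT_comp (measurable_powR (-1))).
  exact: measurable_funX.
apply/funext => x; rewrite powR_inv1 ?sqr_ge0//.
have [->|x0] := eqVneq x 0; first by rewrite mul0r invr0.
by field.
Qed.

Section PathFunctionals.
Context {R : realType}.
Local Notation path := (g_sigma_algebraType (@cylinder R)).

(** Paths are indexed from 0 and environments from 1, hence the predecessor. *)
Definition pathA (x : path) (j : nat) : R := (x j.-1 : R * R).1.
Definition pathB (x : path) (j : nat) : R := (x j.-1 : R * R).2.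

Lemma measurable_pathA j : measurable_fun setT (pathA^~ j).
Proof. exact: (measurableT_comp measurable_fst (measurable_coord _)). Qed.

Lemma measurable_pathB j : measurable_fun setT (pathB^~ j).
Proof. exact: (measurableT_comp measurable_snd (measurable_coord _)). Qed.

Lemma measurable_Pi n : measurable_fun setT (fun x => Pi (pathA x) n).
Proof. by apply: measurable_prod => i _; exact: measurable_pathA. Qed.

Lemma measurable_Rn n : measurable_fun setT (fun x => Rn (pathA x) (pathB x) n).
Proof.
apply: measurable_sum => i; apply: measurable_funM; first exact: measurable_Pi.
exact: measurable_pathB.
Qed.

Lemma measurable_Rinv n : measurable_fun setT (fun x => Rinv (pathA x) (pathB x) n).
Proof.
apply: measurable_sum => i; apply: measurable_funM; last exact: measurable_pathB.
exact: (measurableT_comp measurable_invr (measurable_Pi i)).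
Qed.

End PathFunctionals.

Lemma eq_Pi {R : realType} (a a' : nat -> R) n :
  (forall k, (0 < k)%N -> a k = a' k) -> Pi a n = Pi a' n.
Proof.
by move=> aa; apply: eq_big_nat => k /andP[k0 _]; exact: aa.
Qed.

Lemma eq_Rn {R : realType} (a a' b b' : nat -> R) n :
  (forall k, (0 < k)%N -> a k = a' k) -> (forall k, (0 < k)%N -> b k = b' k) ->
  Rn a b n = Rn a' b' n.
Proof.
move=> aa bb; apply: eq_big_nat => k /andP[k0 _].
by rewrite (eq_Pi _ aa) bb.
Qed.

Lemma eq_Rinv {R : realType} (a a' b b' : nat -> R) n :
  (forall k, (0 < k)%N -> a k = a' k) -> (forall k, (0 < k)%N -> b k = b' k) ->
  Rinv a b n = Rinv a' b' n.
Proof.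
move=> aa bb; apply: eq_big_nat => k /andP[k0 _].
by rewrite (eq_Pi _ aa) bb.
Qed.

(** * The annealed and reversed limits of part (a), and part (b) *)

Section Annealed.
Context {R : realType} {d : measure_display} {Omega : measurableType d}.
Variables (P : probability Omega R) (A B : nat -> Omega -> R).
Variable lf : R -> R -> nat -> R.
Hypothesis iid : iid_env P A B.
Hypothesis AB1 : forall k, (0 < k)%N ->
  P [set w | 0 < A k w /\ 0 < B k w /\ 1 <= A k w + B k w] = 1%E.
Hypothesis lfP : forall a b, 0 < a -> 0 < b -> 1 <= a + b -> is_LF a b (lf a b).
Hypothesis cvR : {ae P, forall w, cvgn (Rinv (A^~ w) (B^~ w))}.
Variable mn : nat -> nat.
Hypothesis mnn : forall n, (mn n <= n)%N.
Hypothesis mnoo : forall M : nat, \forall n \near \oo, (M <= n - mn n)%N.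

Lemma rev_ratio_cvg (a b : nat -> R) : env_ok a b -> cvgn (Rinv a b) ->
  (fun n => (Rinv a b n - Rinv a b (n - mn n)) / (1 + Rinv a b n)) @ \oo --> (0 : R).
Proof.
move=> ok cv.
have sub : (fun n => Rinv a b (n - mn n)) @ \oo --> limn (Rinv a b).
  apply/cvgrPdist_le => e e0; have /cvgrPdist_le/(_ e e0)[M _ hM] := cv.
  by apply: filterS (mnoo M) => n Mn; exact: hM.
have R0 := Rinv_ge0 ok.
have lim0 : 0 <= limn (Rinv a b) by apply: limr_ge => //; exact: nearW.
have -> : (0 : R) = (limn (Rinv a b) - limn (Rinv a b)) / (1 + limn (Rinv a b)).
  by rewrite subrr mul0r.
apply: cvgM; first exact: cvgB cv sub.
apply: cvgV; first by rewrite gt_eqF//; lra.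
by apply: cvgD => //; exact: cvg_cst.
Qed.

Lemma reversed_gt1_cvg : {ae P, forall w,
  (fun n => qP_surv (env_rev lf (A^~ w) (B^~ w) n) n
     [set t | (1 < Zmn t (mn n) n)%N]) @ \oo --> (0 : R)}.
Proof.
apply: filterS2 (ae_env_ok iid AB1) cvR => w ok cv.
under eq_fun do rewrite (rev_gt1 lfP ok)//.
exact: rev_ratio_cvg.
Qed.

(** The absolute value makes the forward ratio nonnegative on every path, as [integral_env_path]
    requires, even where the environment violates its constraints. *)
Let G n (x : g_sigma_algebraType (@cylinder R)) : \bar R :=
  (`| Rn (pathA x) (pathB x) (mn n) * (Pi (pathA x) n + Rn (pathA x) (pathB x) n)^-1 |)%:E.

Let mG n : measurable_fun setT (G n).
Proof.
apply/measurable_EFinP; apply: measurableT_comp => //.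
apply: measurable_funM; first exact: measurable_Rn.
apply: (measurableT_comp measurable_invr).
by apply: measurable_funD; [exact: measurable_Pi|exact: measurable_Rn].
Qed.

(** Reversal of 1, ..., n, continued by the identity on larger indices so as to be injective on all
    of [nat]. *)
Let rev n k := if (k < n)%N then (n - k)%N else k.+1.

Let rev_gt0 n k : (0 < rev n k)%N.
Proof. by rewrite /rev; case: (ltnP k n); lia. Qed.

Let rev_inj n : injective (rev n).
Proof.
move=> i j; rewrite /rev; case: ltnP => ni; case: ltnP => nj; lia.
Qed.

Let GE w n : env_ok (A^~ w) (B^~ w) ->
  G n (env_path A B succn w) =
  (`|qP_surv (env_fwd lf (A^~ w) (B^~ w) n) n [set t | (1 < Zmn t (mn n) n)%N]|)%:E.
Proof.
move=> ok; rewrite (fwd_gt1 lfP ok)// /G.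
have eA k : (0 < k)%N -> pathA (env_path A B succn w) k = A k w by case: k.
have eB k : (0 < k)%N -> pathB (env_path A B succn w) k = B k w by case: k.
by rewrite (eq_Rn _ eA eB) (eq_Rn n eA eB) (eq_Pi _ eA).
Qed.

Let GrevE w n : env_ok (A^~ w) (B^~ w) ->
  G n (env_path A B (rev n) w) =
  (`|(Rinv (A^~ w) (B^~ w) n - Rinv (A^~ w) (B^~ w) (n - mn n)) /
     (1 + Rinv (A^~ w) (B^~ w) n)|)%:E.
Proof.
move=> ok; rewrite -(rev_gt1 lfP ok)//.
have ok' : env_ok (pathA (env_path A B (rev n) w)) (pathB (env_path A B (rev n) w)).
  by move=> k k0; apply: ok; exact: rev_gt0.
have -> : qP_surv (env_rev lf (A^~ w) (B^~ w) n) n [set t | (1 < Zmn t (mn n) n)%N] =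
    qP_surv (env_fwd lf (pathA (env_path A B (rev n) w)) (pathB (env_path A B (rev n) w)) n) n
      [set t | (1 < Zmn t (mn n) n)%N].
  have e k : (k < n)%N -> env_rev lf (A^~ w) (B^~ w) n k =
      env_fwd lf (pathA (env_path A B (rev n) w)) (pathB (env_path A B (rev n) w)) n k.
    by move=> kn; rewrite /env_fwd /env_rev /pathA /pathB /env_path /= /rev kn.
  by rewrite /qP_surv !(eq_qP_laws _ e).
by rewrite (fwd_gt1 lfP ok').
Qed.

(** The reversal changes with [n], so it carries over expectations but not almost sure limits. The
    reversed ratio tends to 0 and is at most 1, so its mean tends to 0 by dominated convergence. *)
Lemma annealed_gt1_cvg :
  (fun n => (\int[P]_w (qP_surv (env_fwd lf (A^~ w) (B^~ w) n) n
     [set t | (1 < Zmn t (mn n) n)%N])%:E)%E) @ \oo --> 0%E.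
Proof.
have s0 k : (0 < k.+1)%N by [].
apply: (@squeeze_cvge _ _ _ _ (cst 0%E) _ (fun n => (\int[P]_w G n (env_path A B (rev n) w))%E)).
- apply: nearW => n.
  rewrite (integral_env_path iid (rev_gt0 n) (@rev_inj n) s0 succn_inj (mG n)); last first.
    by move=> x; rewrite lee_fin.
  apply: ae_integral_bounds => [w||].
  + by rewrite lee_fin.
  + apply: (measurableT_comp (mG n)); exact: (measurable_env_path iid s0).
  + apply: filterS (ae_env_ok iid AB1) => w ok; rewrite GE// ger0_norm//.
    rewrite (fwd_gt1 lfP ok)// divr_ge0 ?(Rn_ge0 ok)// addr_ge0 ?(Rn_ge0 ok)//.
    exact: ltW (Pi_gt0 ok n).
- exact: cvg_cst.
rewrite (_ : 0%E = \int[P]_w (cst 0%E w))%E; last by rewrite integral0.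
have mF n : measurable_fun setT (fun w => G n (env_path A B (rev n) w)).
  apply: (measurableT_comp (mG n)); exact: (measurable_env_path iid (rev_gt0 n)).
have F0 : {ae P, forall w, setT w -> G n (env_path A B (rev n) w) @[n --> \oo] --> cst 0%E w}.
  apply: filterS2 (ae_env_ok iid AB1) cvR => w ok cv _.
  under eq_fun do rewrite GrevE//.
  apply: cvg_EFin; first exact: nearW.
  have h := cvg_norm (rev_ratio_cvg ok cv); rewrite normr0 in h; exact: h.
have F1 : {ae P, forall w n, setT w -> (`|G n (env_path A B (rev n) w)| <= cst 1 w)%E}.
  apply: filterS (ae_env_ok iid AB1) => w ok n _.
  rewrite GrevE// lee_fin normr_id.
  have r0 := Rinv_ge0 ok (n - mn n)%N; have r1 := Rinv_nd ok (leq_subr (mn n) n).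
  have r2 : 0 < 1 + Rinv (A^~ w) (B^~ w) n by rewrite ltr_wpDr// (le_trans r0).
  rewrite ger0_norm ?divr_ge0 ?subr_ge0 ?(ltW r2)// ler_pdivrMr// mul1r; lra.
have int1 : P.-integrable setT (cst 1%E) by exact: finite_measure_integrable_cst.
by have [] := dominated_convergence measurableT mF (measurable_cst 0%E) F0 int1 F1.
Qed.

Lemma reduced_tv_cvg m : {ae P, forall w,
  (fun n => tv (reduced_law lf (A^~ w) (B^~ w) m n)
               (star_law (A^~ w) (B^~ w) m)) @ \oo --> 0%E}.
Proof.
apply: filterS2 (ae_env_ok iid AB1) cvR => w ok cv.
set q := (1 + Rinv (A^~ w) (B^~ w) m) / (1 + Rinv_inf (A^~ w) (B^~ w)).
set r := fun n : nat => (1 + Rinv (A^~ w) (B^~ w) m) / (1 + Rinv (A^~ w) (B^~ w) n).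
apply: (@squeeze_cvge _ _ _ _ (cst 0%E) _ (fun n => (`|r n - q| / q)%:E)).
- near=> n; rewrite (rev_tv lfP ok cv) ?andbT; last by near: n; exact: nbhs_infty_ge.
  set f := fun S => (`|reduced_law lf (A^~ w) (B^~ w) m n S - star_law (A^~ w) (B^~ w) m S|)%:E.
  apply: (@le_trans _ _ (f set0)); first by rewrite lee_fin.
  by apply: ereal_sup_ubound; exists set0.
- exact: cvg_cst.
apply: cvg_EFin; first exact: nearW.
have q0 : 0 < 1 + Rinv_inf (A^~ w) (B^~ w).
  by have := Rinv_le_inf ok cv 0; have := Rinv_ge0 ok 0; lra.
have rq : r @ \oo --> q.
  apply: cvgM; first exact: cvg_cst.
  apply: cvgV; first by rewrite gt_eqF.
  by apply: cvgD; [exact: cvg_cst|exact: cv].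
have -> : (0 : R) = `|q - q| / q by rewrite subrr normr0 mul0r.
apply: cvgM; last exact: cvg_cst.
by apply: cvg_norm; apply: cvgB => //; exact: cvg_cst.
Unshelve. all: by end_near.
Qed.

End Annealed.

(** * A strong law of large numbers *)

Section SummableExpectations.
Context {R : realType} {d : measure_display} {T : measurableType d}.
Variable mu : {measure set T -> \bar R}.

(** The sum of the [f k] has finite integral, hence is finite almost everywhere, and its terms
    vanish. *)
Lemma ae_cvg0_summable (f : nat -> T -> R) :
  (forall k, measurable_fun setT (f k)) -> (forall k w, 0 <= f k w) ->
  (\sum_(k <oo) \int[mu]_w (f k w)%:E < +oo)%E ->
  {ae mu, forall w, (fun k => f k w) @ \oo --> (0 : R)}.
Proof.
move=> mf f0 foo.
have mE k : measurable_fun setT (fun w => (f k w)%:E) by exact/measurable_EFinP.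
have f0E k w : (0 <= (f k w)%:E)%E by rewrite lee_fin.
pose g w := (\sum_(k <oo) (f k w)%:E)%E.
have ig : mu.-integrable setT g.
  apply/integrableP; split; first exact: ge0_emeasurable_sum.
  under eq_integral do rewrite gee0_abs ?nneseries_ge0//.
  by rewrite integral_nneseries.
apply: filterS (integrable_ae measurableT ig) => w /(_ Logic.I) gfin.
apply: cvg_series_cvg_0; apply: nnseries_is_cvg => //.
by have := gfin; rewrite fin_numE => /andP[_]; rewrite -ltey.
Qed.

End SummableExpectations.

(** Telescoping through 1/(x + 1)^2 <= 1/x - 1/(x + 1). *)
Lemma inv_sq_series {R : realType} n :
  \sum_(0 <= k < n) ((k.+1%:R : R) ^+ 2)^-1 <= 2.
Proof.
have H m : \sum_(0 <= k < m.+1) ((k.+1%:R : R) ^+ 2)^-1 <= 2 - m.+1%:R^-1.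
  elim: m => [|m IH]; first by rewrite big_nat1 expr1n invr1; lra.
  rewrite big_nat_recr//=; apply: le_trans (lerD IH (lexx _)) _.
  rewrite -[m.+2%:R]natr1; set x : R := m.+1%:R.
  have x0 : 0 < x by rewrite ltr0n.
  have -> : (x + 1)^-1 = x^-1 - (x * (x + 1))^-1.
    by field; rewrite !gt_eqF//=; lra.
  have : ((x + 1) ^+ 2)^-1 <= (x * (x + 1))^-1.
    by rewrite lef_pV2 ?posrE ?mulr_gt0 ?exprn_gt0//; nra.
  move: ((x + 1) ^- 2) (x^-1) ((x * (x + 1))^-1) => p q r; lra.
case: n => [|n]; first by rewrite big_nil.
by apply: le_trans (H n) _; rewrite gerDl oppr_le0 invr_ge0.
Qed.

Section StrongLaw.
Context {R : realType} {d : measure_display} {T : measurableType d}.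
Variables (P : probability T R) (Y : nat -> {RV P >-> R}).
Hypothesis ident : forall i C, measurable C -> P (Y i @^-1` C) = P (Y 0%N @^-1` C).
Hypothesis ind : forall i j, i != j -> forall C D, measurable C -> measurable D ->
  P ((Y i @^-1` C) `&` (Y j @^-1` D)) = (P (Y i @^-1` C) * P (Y j @^-1` D))%E.
Hypothesis m2 : (\int[P]_w ((Y 0%N w) ^+ 2)%:E < +oo)%E.
Local Open Scope ereal_scope.

Let ge0_ident (g : R -> R) i : measurable_fun setT g -> (forall y, (0 <= g y)%R) ->
  \int[P]_w (g (Y i w))%:E = \int[P]_w (g (Y 0%N w))%:E.
Proof.
move=> mg g0; have mE : measurable_fun setT (EFin \o g) by exact/measurable_EFinP.
have := ge0_integral_distribution (Y i) mE (fun y => g0 y).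
have := ge0_integral_distribution (Y 0%N) mE (fun y => g0 y).
move=> <- <-; apply: eq_measure_integral => C mC _; exact: ident.
Qed.

Let mY i : measurable_fun setT (Y i). Proof. exact: measurable_funP. Qed.

Let intY2 i : P.-integrable setT (fun w => ((Y i w) ^+ 2)%:E).
Proof.
apply/integrableP; split.
  by apply/measurable_EFinP; apply: measurable_funX.
under eq_integral do rewrite gee0_abs ?lee_fin ?sqr_ge0//.
rewrite (@ge0_ident (fun y => y ^+ 2)%R)//; last by move=> y; rewrite sqr_ge0.
Qed.

Let le_int (f : T -> R) (g : T -> R) : measurable_fun setT f ->
  P.-integrable setT (fun w => (g w)%:E) -> (forall w, `|f w| <= g w)%R ->
  P.-integrable setT (fun w => (f w)%:E).
Proof.
move=> mf ig fg; apply: (le_integrable measurableT _ _ ig).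
  exact/measurable_EFinP.
move=> w _; rewrite !abse_EFin lee_fin (le_trans (fg w))// ler_norm//.
Qed.

Lemma integrable_sq_ident i : P.-integrable setT (fun w => (Y i w)%:E).
Proof.
apply: (le_int (g := fun w => (1 + (Y i w) ^+ 2)%R)) => //.
  have := integrableD measurableT (finite_measure_integrable_cst P 1 measurableT) (intY2 i).
  by apply: eq_integrable.
by move=> w; rewrite ler_norml; apply/andP; split; nra.
Qed.

Let intY := integrable_sq_ident.

Definition rv_mean := fine (\int[P]_w (Y 0%N w)%:E).

Let EY i : \int[P]_w (Y i w)%:E = rv_mean%:E.
Proof.
rewrite /rv_mean fineK; last exact: integrable_fin_num.
have mE : measurable_fun setT (@EFin R) by exact/measurable_EFinP.
have := integral_distribution (X := Y i) mE (intY i).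
have := integral_distribution (X := Y 0%N) mE (intY 0%N).
by move=> <- <-; apply: eq_measure_integral => C mC _; exact: ident.
Qed.

Let Z i w : R := (Y i w - rv_mean)%R.

Let mZ i : measurable_fun setT (Z i).
Proof. by apply: measurable_funB. Qed.

Let intZ i : P.-integrable setT (fun w => (Z i w)%:E).
Proof.
have := integrableB measurableT (intY i) (finite_measure_integrable_cst P rv_mean measurableT).
by apply: eq_integrable.
Qed.

Let EZ i : \int[P]_w (Z i w)%:E = 0.
Proof.
have := integralB measurableT (intY i) (finite_measure_integrable_cst P rv_mean measurableT).
have -> : \int[P]_x (EFin \o cst rv_mean) x = rv_mean%:E.
  apply: (@eq_trans _ _ (rv_mean%:E * P setT)); first exact: (integral_cst P measurableT rv_mean%:E).
  by rewrite probability_setT mule1.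
by rewrite EY subee// => <-.
Qed.

Let intZ2 i : P.-integrable setT (fun w => ((Z i w) ^+ 2)%:E).
Proof.
apply: (le_int (g := fun w => (2 * (Y i w) ^+ 2 + 2 * rv_mean ^+ 2)%R)).
- exact: measurable_funX.
- have := integrableD measurableT (integrableZl measurableT 2%R (intY2 i))
    (finite_measure_integrable_cst P (2 * rv_mean ^+ 2)%R measurableT).
  by apply: eq_integrable.
- by move=> w; rewrite ger0_norm ?sqr_ge0// /Z; have := sqr_ge0 (Y i w + rv_mean); nra.
Qed.

Let intZZ i j : P.-integrable setT (fun w => (Z i w * Z j w)%:E).
Proof.
apply: (le_int (g := fun w => ((Z i w) ^+ 2 + (Z j w) ^+ 2)%R)).
- exact: measurable_funM.
- have := integrableD measurableT (intZ2 i) (intZ2 j).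
  by apply: eq_integrable.
- by move=> w; rewrite ler_norml; apply/andP; split; nra.
Qed.

Let EZZ i j : i != j -> \int[P]_w (Z i w * Z j w)%:E = 0.
Proof.
move=> ij.
have mp : measurable_fun setT (fun w => (Y i w, Y j w)) by apply/measurable_fun_pair.
pose pr_mixin := isMeasurableFun.Build _ _ _ _ _ mp.
pose pr : {mfun T >-> (R * R)%type} := HB.pack (fun w => (Y i w, Y j w)) pr_mixin.
pose m1 := distribution P (Y i); pose m2' := distribution P (Y j).
(* Independence identifies the joint law of the pair with the product of its marginals, so Fubini
   makes the covariance vanish. *)
have prE X : measurable X -> (m1 \x m2')%E X = distribution P pr X.
  move=> mX; apply: product_measure_unique => // C D mC mD.
  by rewrite -[RHS]ind.
pose f (z : R * R) := ((z.1 - rv_mean) * (z.2 - rv_mean))%:E.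
have mf : measurable_fun setT f.
  by apply/measurable_EFinP; apply: measurable_funM; apply: measurable_funB.
have -> : \int[P]_w (Z i w * Z j w)%:E = \int[distribution P pr]_z f z.
  by rewrite (integral_distribution (X := pr))//; exact: (intZZ i j).
have -> : \int[distribution P pr]_z f z = \int[(m1 \x m2')%E]_z f z.
  by apply: eq_measure_integral => C mC _; apply/esym; exact: prE.
rewrite -integral12_prod_meas1; last first.
  apply/integrableP; split => //.
  rewrite (eq_measure_integral (distribution P pr)); last by move=> C mC _; exact: prE.
  rewrite ge0_integral_distribution//; last exact: measurableT_comp.
  by have /integrableP[] := intZZ i j.
transitivity (\int[m1]_x (cst 0 x)); last by rewrite integral0.
apply: eq_integral => x _.
transitivity (\int[P]_w ((x - rv_mean)%:E * (Z j w)%:E)); last first.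
  by rewrite integralZl// EZ mule0.
apply: (integral_distribution (X := Y j) (f := fun y => f (x, y))).
  by apply: (measurableT_comp mf); apply/measurable_fun_pair.
exact: (integrableZl measurableT (x - rv_mean)%R (intZ j)).
Qed.

Let v := fine (\int[P]_w ((Z 0%N w) ^+ 2)%:E).

Let EZ2 i : \int[P]_w (Z i w * Z i w)%:E = v%:E.
Proof.
rewrite /v fineK; last exact: integrable_fin_num.
apply: (@ge0_ident (fun y => (y - rv_mean) ^+ 2)%R); last by move=> y; exact: sqr_ge0.
by apply: measurable_funX; apply: measurable_funB.
Qed.

Let v0 : (0 <= v)%R.
Proof. by apply: fine_ge0; apply: integral_ge0 => w _; rewrite lee_fin sqr_ge0. Qed.

Let SQ m n w : R := ((\sum_(m <= i < n) Z i w) ^+ 2)%R.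

Let SQE m n w : (SQ m n w)%:E =
  \sum_(m <= i < n) \sum_(m <= j < n) (Z i w * Z j w)%:E.
Proof.
under eq_bigr do rewrite sumEFin.
by rewrite sumEFin; congr EFin; rewrite /SQ expr2 big_distrlr.
Qed.

Let intSQ m n : P.-integrable setT (fun w => (SQ m n w)%:E).
Proof.
apply: (eq_integrable measurableT (fun w => \sum_(m <= i < n) \sum_(m <= j < n) (Z i w * Z j w)%:E)).
  by move=> w _; rewrite SQE.
apply: integrable_sum => // i _; apply: integrable_sum => // j _; exact: intZZ.
Qed.

Let ESQ m n : \int[P]_w (SQ m n w)%:E = ((n - m)%:R * v)%:E.
Proof.
under eq_integral do rewrite SQE.
rewrite integral_sum//; last first.
  by move=> i; apply: integrable_sum => // j _; exact: intZZ.
transitivity (\sum_(m <= i < n) v%:E).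
  rewrite big_nat [RHS]big_nat; apply: eq_bigr => i /andP[mi ni].
  rewrite integral_sum//.
  rewrite (bigD1_seq i)/= ?mem_index_iota ?mi ?iota_uniq//.
  by rewrite EZ2 big1 ?adde0// => j ji; rewrite EZZ// eq_sym.
by rewrite sumEFin sumr_const_nat mulr_natl.
Qed.

(* [V k] controls the centred partial sum at the square (k+1)^2 and all its
   increments up to the next square; its expectation is O(1/k^2). *)
Let V k w : R := ((k.+1%:R ^+ 4)^-1 * (SQ 0 (k.+1 ^ 2) w +
  \sum_(0 <= j < (k.+1).*2.+1) SQ (k.+1 ^ 2) (k.+1 ^ 2 + j) w))%R.

Let SQ0 m n w : (0 <= SQ m n w)%R. Proof. exact: sqr_ge0. Qed.

Let V0 k w : (0 <= V k w)%R.
Proof. by rewrite mulr_ge0 ?invr_ge0 ?exprn_ge0// addr_ge0// sumr_ge0. Qed.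

Let mSQ m n : measurable_fun setT (SQ m n).
Proof. by apply: measurable_funX; apply: measurable_sum. Qed.

Let sum_upto M : (\sum_(0 <= j < M.*2.+1) j = M * (2 * M + 1))%N.
Proof.
elim: M => [|M IH]; first by rewrite big_nat1.
rewrite doubleS big_nat_recr// big_nat_recr//= IH; lia.
Qed.

Let EV k : \int[P]_w (V k w)%:E <= (4 * v * (k.+1%:R ^+ 2)^-1)%:E.
Proof.
set K := k.+1; set N := (K.*2.+1)%N.
pose W w := \sum_(0 <= j < N) (SQ (K ^ 2) (K ^ 2 + j) w)%:E.
have iW : P.-integrable setT W by apply: integrable_sum => // j _; exact: intSQ.
have iS := integrableD measurableT (intSQ 0 (K ^ 2)) iW.
have -> : \int[P]_w (V k w)%:E =
    ((K%:R ^+ 4)^-1)%:E * \int[P]_w ((SQ 0 (K ^ 2) w)%:E + W w).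
  rewrite -integralZl//; apply: eq_integral => w _.
  by rewrite /V /W sumEFin -EFinD -EFinM.
rewrite integralD// ESQ subn0 /W integral_sum; [|by []|by move=> j; exact: intSQ].
under eq_bigr do rewrite ESQ addKn.
rewrite sumEFin -EFinD -EFinM lee_fin -mulr_suml -mulrDl.
have -> : (\sum_(0 <= j < N) (j%:R : R) = K%:R * (2 * K%:R + 1))%R.
  rewrite -natr_sum (_ : \sum_(0 <= j < N) j = K * (2 * K + 1))%N.
    by rewrite natrM natrD natrM.
  exact: sum_upto.
rewrite natrX; set x : R := K%:R.
have x1 : (1 <= x)%R by rewrite ler1n.
(* The variances add up to (x^2 + x (2 x + 1)) v, which is at most 4 x^2 v since x >= 1. *)
have -> : (4 * v * (x ^+ 2)^-1 = (x ^+ 4)^-1 * ((4 * x ^+ 2) * v))%R.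
  by field; rewrite gt_eqF//; lra.
apply: ler_wpM2l; first by rewrite invr_ge0 exprn_ge0//; lra.
by apply: ler_wpM2r => //; nra.
Qed.

Let V_cvg0 : {ae P, forall w, (fun k => V k w) @ \oo --> (0%R : R)}.
Proof.
apply: ae_cvg0_summable => [k|//|].
  apply: measurable_funM => //; apply: measurable_funD => //.
  exact: measurable_sum.
apply: (@le_lt_trans _ _ (4 * v * 2)%:E); last exact: ltry.
apply: lime_le; first by apply: is_cvg_nneseries => k _ _; apply: integral_ge0 => w _; rewrite lee_fin.
apply: nearW => n; apply: (@le_trans _ _ (\sum_(0 <= k < n) (4 * v * (k.+1%:R ^+ 2)^-1)%:E)).
  by apply: lee_sum => k _; exact: EV.
rewrite sumEFin lee_fin -mulr_sumr; apply: ler_wpM2l; first by rewrite mulr_ge0.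
exact: inv_sq_series.
Qed.

Let sqrt_bracket n : (0 < n)%N -> exists k, (k.+1 ^ 2 <= n < k.+2 ^ 2)%N.
Proof.
elim: n => [//|[_ _|n /(_ isT)[k /andP[k1 k2]] _]]; first by exists 0%N.
have [e|ne] := eqVneq n.+2 (k.+2 ^ 2)%N; [exists k.+1|exists k]; nia.
Qed.

Lemma strong_law : {ae P, forall w,
  (fun n => (\sum_(0 <= k < n) Y k w) / n%:R)%R @ \oo --> (rv_mean : R)}.
Proof.
apply: filterS V_cvg0 => w Vw; apply/cvgrPdist_le => e e0.
(* The factor 1/2 pays for (T1 + T2)^2 <= 2 (T1^2 + T2^2), where the sum is cut at the last square
   below [n]. *)
have /cvgrPdist_le/(_ (e ^+ 2 / 2)%R) := Vw; rewrite divr_gt0 ?exprn_gt0// => /(_ isT)[K _ VK].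
exists (K.+1 ^ 2)%N => // n /= Kn.
have n0 : (0 < n)%N by apply: leq_trans Kn; rewrite expn_gt0.
have [k /andP[k1 k2]] := sqrt_bracket n0.
have Kk : (K <= k)%N by nia.
have := VK k Kk; rewrite /= sub0r normrN ger0_norm// => Vk.
have n0' : (0 < (n%:R : R))%R by rewrite ltr0n.
set T1 : R := (\sum_(0 <= i < k.+1 ^ 2) Z i w)%R.
set T2 : R := (\sum_(k.+1 ^ 2 <= i < n) Z i w)%R.
have TE : (\sum_(0 <= i < n) Y i w = T1 + T2 + n%:R * rv_mean)%R.
  rewrite /T1 /T2 -big_cat_nat//= /Z sumrB sumr_const_nat subn0.
  by rewrite mulr_natl subrK.
have VE : (T1 ^+ 2 + T2 ^+ 2 <= k.+1%:R ^+ 4 * (e ^+ 2 / 2))%R.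
  apply: (@le_trans _ _ (k.+1%:R ^+ 4 * V k w)%R); last by rewrite ler_wpM2l ?exprn_ge0.
  rewrite /V mulrA divff ?mul1r ?expf_neq0 ?pnatr_eq0// lerD2l.
  have jn : (n - k.+1 ^ 2 < (k.+1).*2.+1)%N by nia.
  rewrite (bigD1_seq (n - k.+1 ^ 2)%N) ?mem_index_iota ?iota_uniq//.
  by rewrite subnKC// lerDl sumr_ge0.
have kn : (k.+1%:R ^+ 2 <= n%:R :> R)%R by rewrite -natrX ler_nat.
rewrite TE mulrDl mulrAC divff ?gt_eqF// mul1r opprD addrCA subrr addr0 normrN.
rewrite normf_div (ger0_norm (ltW n0')) ler_pdivrMr//.
rewrite -(ler_pXn2r (n := 2))// ?nnegrE// ?mulr_ge0// ?(ltW e0)// ?(ltW n0')//.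
rewrite real_normK ?num_real// exprMn.
have h1 : ((T1 + T2) ^+ 2 <= 2 * (T1 ^+ 2 + T2 ^+ 2))%R.
  by have := sqr_ge0 (T1 - T2); nra.
have h2 : (k.+1%:R ^+ 4 <= n%:R ^+ 2 :> R)%R.
  by rewrite (exprM _ 2 2); apply: lerXn2r; rewrite ?nnegrE ?exprn_ge0// ltW.
have h3 : (k.+1%:R ^+ 4 * e ^+ 2 <= n%:R ^+ 2 * e ^+ 2 :> R)%R.
  by rewrite ler_wpM2r// sqr_ge0.
by apply: (le_trans h1); apply: le_trans (_ : (_ <= k.+1%:R ^+ 4 * e ^+ 2)%R) _; lra.
Qed.
End StrongLaw.

(** * Positivity of the drift *)

Section Drift.
Variable R : realType.
Implicit Types a b : nat -> R.

Lemma Pi_shift a n : Pi a n.+1 = a 1%N * Pi (fun k => a k.+1) n.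
Proof.
elim: n => [|n IH]; first by rewrite PiS !Pi0 mul1r mulr1.
by rewrite PiS IH PiS mulrA.
Qed.

Lemma Rinv_shift a b n : Rinv a b n.+1 =
  (a 1%N)^-1 * (b 1%N + Rinv (fun k => a k.+1) (fun k => b k.+1) n).
Proof.
elim: n => [|n IH].
  by rewrite RinvS !Rinv0 PiS Pi0 mul1r add0r addr0.
by rewrite RinvS IH [in RHS]RinvS Pi_shift invfM -mulrA -mulrDr addrA.
Qed.

Lemma env_ok_shift a b : env_ok a b -> env_ok (fun k => a k.+1) (fun k => b k.+1).
Proof. by move=> ok k k0; exact: ok. Qed.

Lemma Rinv_lim_shift a b : env_ok a b -> cvgn (Rinv a b) ->
  let a' := fun k => a k.+1 in let b' := fun k => b k.+1 in
  [/\ cvgn (Rinv a' b'), 0 < limn (Rinv a' b') &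
    limn (Rinv a b) = (a 1%N)^-1 * (b 1%N + limn (Rinv a' b'))].
Proof.
move=> ok cv a' b'; have [a1 [b1 _]] := ok 1%N isT.
have ok' := env_ok_shift ok.
have E n : Rinv a' b' n = a 1%N * Rinv a b n.+1 - b 1%N.
  rewrite Rinv_shift -/a' -/b'; field; rewrite gt_eqF//.
have cv' : Rinv a' b' @ \oo --> a 1%N * limn (Rinv a b) - b 1%N.
  rewrite (funext E); apply: cvgB; last exact: cvg_cst.
  by apply: cvgM; [exact: cvg_cst|rewrite (cvg_shiftS (Rinv a b))].
split; first exact: cvgP cv'.
  have := nondecreasing_cvgn_le (Rinv_nd ok') (cvgP _ cv') 1%N.
  by apply: lt_le_trans; have := Rinv_lt ok' 0; rewrite Rinv0.
by rewrite (cvg_lim _ cv')//; field; rewrite gt_eqF.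
Qed.

Definition clip (K : nat) (y : R) : R := Num.max (- K%:R) (Num.min y K%:R).

Lemma clip_bound K y : `|clip K y| <= K%:R.
Proof.
have K0 : 0 <= (K%:R : R) by [].
rewrite ler_norml /clip le_max lexx/= ge_max; apply/andP; split; first by lra.
by rewrite ge_min lexx orbT.
Qed.

(** Clipping is monotone and 1-Lipschitz, so it shrinks differences; a lower bound survives only if
    it is not positive. This is why |X| rather than X is added to the clipped difference later. *)
Lemma clip_sub_ge K y z c : 0 <= c -> - c <= y - z -> - c <= clip K y - clip K z.
Proof.
have K0 : 0 <= (K%:R : R) by [].
rewrite /clip => c0 yz.
case: (leP y K%:R) => yK; case: (leP z K%:R) => zK;
  case: (leP (- K%:R) y) => h1; case: (leP (- K%:R) z) => h2;
  case: (leP (- K%:R) (K%:R : R)) => h3; lra.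
Qed.

Lemma clip_id K y : `|y| <= K%:R -> clip K y = y.
Proof.
by rewrite ler_norml => /andP[y1 y2]; rewrite /clip min_l// max_r.
Qed.

Lemma measurable_clip K : measurable_fun setT (clip K).
Proof.
by apply: measurable_maxr => //; apply: measurable_minr.
Qed.

End Drift.

Section PositiveDrift.
Context {R : realType} {d : measure_display} {Omega : measurableType d}.
Variables (P : probability Omega R) (A B : nat -> Omega -> R).
Hypothesis iid : iid_env P A B.
Hypothesis AB1 : forall k, (0 < k)%N ->
  P [set w | 0 < A k w /\ 0 < B k w /\ 1 <= A k w + B k w] = 1%E.
Hypothesis cvR : {ae P, forall w, cvgn (Rinv (A^~ w) (B^~ w))}.
Hypothesis intX : P.-integrable setT (fun w => (ln (A 1 w))%:E).

Let X w := ln (A 1%N w).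

Let mX : measurable_fun setT X.
Proof. exact: (measurableT_comp (@measurable_ln R) (measurable_A iid _)). Qed.

(** The limit superior yields a measurable function of every path; it is the logarithm of the limit
    wherever [Rinv] converges. *)
Let lnR (x : g_sigma_algebraType (@cylinder R)) : R :=
  ln (fine (limn_esup (fun n => (Rinv (pathA x) (pathB x) n)%:E))).

Let mlnR : measurable_fun setT lnR.
Proof.
apply: (measurableT_comp (@measurable_ln R)).
apply: (measurableT_comp (fine_measurable measurableT)).
apply: measurable_fun_limn_esup => n; apply/measurable_EFinP; exact: measurable_Rinv.
Qed.

Let s1 (k : nat) := k.+2.
Let Y0 w := lnR (env_path A B succn w).
Let Y1 w := lnR (env_path A B s1 w).

Let s1_gt0 k : (0 < s1 k)%N. Proof. by []. Qed.
Let s1_inj : injective s1. Proof. by move=> i j []. Qed.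
Let s0_gt0 k : (0 < k.+1)%N. Proof. by []. Qed.

Let mY0 : measurable_fun setT Y0.
Proof. apply: (measurableT_comp mlnR); exact: (measurable_env_path iid s0_gt0). Qed.

Let mY1 : measurable_fun setT Y1.
Proof. apply: (measurableT_comp mlnR); exact: (measurable_env_path iid s1_gt0). Qed.

Let lnRE x : cvgn (Rinv (pathA x) (pathB x)) ->
  lnR x = ln (limn (Rinv (pathA x) (pathB x))).
Proof.
move=> cv; congr ln.
have cvE : (Rinv (pathA x) (pathB x) n)%:E @[n --> \oo] --> (limn (Rinv (pathA x) (pathB x)))%:E.
  by apply: cvg_EFin => //; exact: nearW.
by rewrite is_cvg_limn_esupE; [rewrite (cvg_lim _ cvE)|exact: cvgP cvE].
Qed.

Let drift_gt0 : {ae P, forall w, 0 < Y0 w - Y1 w + X w}.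
Proof.
apply: filterS2 (ae_env_ok iid AB1) cvR => w ok cv.
have [cv' r0 rE] := Rinv_lim_shift ok cv; have [a1 [b1 _]] := ok 1%N isT.
have E0 : Rinv (pathA (env_path A B succn w)) (pathB (env_path A B succn w)) =
    Rinv (A^~ w) (B^~ w).
  by apply/funext => n; apply: eq_Rinv => -[].
have E1 : Rinv (pathA (env_path A B s1 w)) (pathB (env_path A B s1 w)) =
    Rinv (fun k => A k.+1 w) (fun k => B k.+1 w).
  by apply/funext => n; apply: eq_Rinv => -[].
rewrite /Y0 /Y1 !lnRE ?E0 ?E1// rE lnM ?posrE ?invr_gt0//; last by rewrite addr_gt0.
rewrite lnV ?posrE// /X.
set r' := limn _ in r0 *.
have : ln r' < ln (B 1%N w + r') by rewrite ltr_ln ?posrE ?addr_gt0// ltrDr.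
lra.
Qed.

Let intclip K (Y : Omega -> R) : measurable_fun setT Y ->
  P.-integrable setT (fun w => (clip K (Y w))%:E).
Proof.
move=> mY; apply: (le_integrable measurableT _ _ (finite_measure_integrable_cst P K%:R measurableT)).
  by apply/measurable_EFinP; apply: (measurableT_comp (@measurable_clip R K)).
by move=> w _; rewrite /= lee_fin (le_trans (clip_bound _ _))// ler_norm.
Qed.

Let clip_stationary K : (\int[P]_w (clip K (Y0 w))%:E = \int[P]_w (clip K (Y1 w))%:E)%E.
Proof.
(* Adding [K] makes the integrand nonnegative, as [integral_env_path] requires; the constant is
   cancelled at the end. *)
pose H x := (clip K (lnR x) + K%:R)%:E.
have mH : measurable_fun setT H.
  apply/measurable_EFinP; apply: measurable_funD => //.
  exact: (measurableT_comp (@measurable_clip R K) mlnR).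
have H0 x : (0 <= H x)%E.
  by rewrite lee_fin; have := clip_bound K (lnR x); rewrite ler_norml; lra.
have := integral_env_path iid s0_gt0 succn_inj s1_gt0 s1_inj mH H0.
have E (Y : Omega -> R) : measurable_fun setT Y -> (\int[P]_w (clip K (Y w) + K%:R)%:E =
    \int[P]_w (clip K (Y w))%:E + \int[P]_w (cst K%:R%:E w))%E.
  move=> mY; rewrite -integralD//; first exact: intclip.
  exact: (finite_measure_integrable_cst P K%:R measurableT).
have fK : (\int[P]_w (cst K%:R%:E w))%E \is a fin_num.
  by apply: integrable_fin_num => //; exact: (finite_measure_integrable_cst P K%:R measurableT).
rewrite (E _ mY0) (E _ mY1); move: (\int[P]_w cst K%:R%:E w)%E fK => c cfin h.
by rewrite -[LHS](addeK _ cfin) h addeK.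
Qed.

(** The maximum makes this nonnegative everywhere, for Fatou's lemma, and is almost surely attained
    by the second argument. The clipped terms cancel in mean, so the integral is that of |X| for
    every [K]. *)
Let F (K : nat) w : R := Num.max 0 (clip K (Y0 w) - clip K (Y1 w) + `|X w|).

Let mF K : measurable_fun setT (F K).
Proof.
apply: measurable_maxr => //; apply: measurable_funD; last exact: measurableT_comp.
by apply: measurable_funB; exact: (measurableT_comp (@measurable_clip R K)).
Qed.

Let intabsX : P.-integrable setT (fun w => (`|X w|)%:E).
Proof. exact: integrable_norm. Qed.

Let EF K : (\int[P]_w (F K w)%:E = \int[P]_w (`|X w|)%:E)%E.
Proof.
pose g w := (clip K (Y0 w) - clip K (Y1 w) + `|X w|)%:E.
have i0 := intclip K mY0; have i1 := intclip K mY1.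
have -> : (\int[P]_w (F K w)%:E = \int[P]_w g w)%E.
  apply: ae_eq_integral => //.
  - exact/measurable_EFinP.
  - apply/measurable_EFinP; apply: measurable_funD; last exact: measurableT_comp.
    by apply: measurable_funB; exact: (measurableT_comp (@measurable_clip R K)).
  - apply: filterS drift_gt0 => w dw _; congr EFin; rewrite /F max_r//.
    have := @clip_sub_ge R K (Y0 w) (Y1 w) `|X w|; rewrite normr_ge0 => /(_ isT).
    have := ler_norm (X w) => ?.
    have -> : - `|X w| <= Y0 w - Y1 w by lra.
    by move=> /(_ isT); lra.
have -> : (\int[P]_w g w = \int[P]_w (((clip K (Y0 w))%:E - (clip K (Y1 w))%:E) + (`|X w|)%:E))%E.
  by apply: eq_integral.
rewrite integralD//; last exact: integrableB.
rewrite (integralB _ i0 i1)// clip_stationary subee ?add0e//.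
exact: integrable_fin_num.
Qed.

Let G w : R := Num.max 0 (Y0 w - Y1 w + `|X w|).

Let mG : measurable_fun setT G.
Proof.
apply: measurable_maxr => //; apply: measurable_funD; last exact: measurableT_comp.
exact: measurable_funB.
Qed.

Let limF w : (F K w)%:E @[K --> \oo] --> (G w)%:E.
Proof.
apply: cvg_EFin; first exact: nearW.
apply: cvg_near_cst.
have nK (y : R) : \forall K \near \oo, `|y| <= K%:R by exact: nbhs_infty_ger.
near=> K; rewrite /F /G /= !clip_id//; near: K; exact: nK.
Unshelve. all: by end_near. Qed.

Let intG_le : (\int[P]_w (G w)%:E <= \int[P]_w (`|X w|)%:E)%E.
Proof.
have mFE K : measurable_fun setT (fun w => (F K w)%:E) by exact/measurable_EFinP.
have F0 K w : setT w -> (0 <= (F K w)%:E)%E by rewrite lee_fin le_max lexx.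
have := fatou P measurableT mFE F0.
have -> : limn_einf (fun K => \int[P]_w (F K w)%:E)%E = (\int[P]_w (`|X w|)%:E)%E.
  rewrite (_ : (fun K => _) = cst (\int[P]_w (`|X w|)%:E)%E); last by apply/funext => K; exact: EF.
  by rewrite is_cvg_limn_einfE; [exact: lim_cst|exact: is_cvg_cst].
congr (_ <= _)%E; apply: eq_integral => w _.
by rewrite is_cvg_limn_einfE; [rewrite (cvg_lim _ (@limF w))|exact: cvgP (@limF w)].
Qed.

Lemma drift_mean_gt0 : (0 < \int[P]_w (ln (A 1 w))%:E)%E.
Proof.
have G0 w : 0 <= G w by rewrite le_max lexx.
have intG : P.-integrable setT (fun w => (G w)%:E).
  apply/integrableP; split; first exact/measurable_EFinP.
  under eq_integral do rewrite gee0_abs ?lee_fin ?G0//.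
  apply: le_lt_trans intG_le _.
  by have /integrable_fin_num := intabsX; rewrite ge0_fin_numE ?integral_ge0// => ->.
(* Almost surely this is Y0 - Y1 + X, written as a combination of integrable terms although Y0 and
   Y1 need not be integrable. *)
pose W w := ((G w)%:E - (`|X w|)%:E + (X w)%:E)%E.
have intGX := integrableB measurableT intG intabsX.
have intW : P.-integrable setT W by exact: integrableD.
have EW : (\int[P]_w W w <= \int[P]_w (X w)%:E)%E.
  rewrite /W integralD// integralB//.
  rewrite -[leRHS]add0e leeD2r// sube_le0//.
have Wpos : {ae P, forall w, (0 < W w)%E}.
  apply: filterS drift_gt0 => w dw; rewrite /W -EFinB -EFinD lte_fin /G.
  by rewrite max_r; have := ler_norm (X w); lra.
(* If the mean of X were at most 0, the almost surely positive [W] would have integral 0. *)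
rewrite ltNge; apply/negP => X0.
have W0 : (\int[P]_w `|W w| = 0)%E.
  apply/eqP; rewrite eq_le integral_ge0// andbT.
  have -> : (\int[P]_w `|W w| = \int[P]_w W w)%E.
    apply: ae_eq_integral => //.
    - by apply: measurableT_comp => //; case/integrableP: intW.
    - by case/integrableP: intW.
    - by apply: filterS Wpos => w /ltW ? _; rewrite gee0_abs.
  exact: le_trans EW X0.
have mW : measurable_fun setT W by case/integrableP: intW.
have W_eq0 := (ae_eq_integral_abs P measurableT mW).1 W0.
have [N [mN N0 sub]] : {ae P, forall w, False}.
  apply: filterS2 W_eq0 Wpos => w /(_ Logic.I) -> /=.
  by rewrite ltxx.
have : P setT = 0%E.
  by apply/eqP; rewrite -measure_le0 -N0; apply: le_measure; rewrite ?inE// => w _; exact: sub.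
by rewrite probability_setT => -[] /eqP; rewrite oner_eq0.
Qed.

End PositiveDrift.

(** * Growth estimates along one typical environment *)

Section GrowthRates.
Variable R : realType.
Variables a b : nat -> R.
Hypothesis ok : env_ok a b.

Lemma ln_Pi n : ln (Pi a n) = \sum_(0 <= k < n) ln (a k.+1).
Proof.
elim: n => [|n IH]; first by rewrite Pi0 big_nil ln1.
have [an _] := ok (ltn0Sn n).
by rewrite PiS lnM ?posrE ?(Pi_gt0 ok)// IH big_nat_recr.
Qed.

(** Squaring e^y >= y at y = eta n / 2 gives e^(eta n) >= (eta n / 2)^2, whence the 4. *)
Lemma mulr_expN_le (eta : R) n : 0 < eta -> (0 < n)%N ->
  n%:R * expR (- (eta * n%:R)) <= 4 / eta ^+ 2 / n%:R.
Proof.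
move=> eta0 n0; have x0 : 0 < (n%:R : R) by rewrite ltr0n.
set x : R := n%:R in x0 *; rewrite expRN.
have h : eta * x / 2 <= expR (eta * x / 2).
  by apply: le_trans (expR_ge1Dx _); rewrite lerDr.
have e0 : 0 < eta * x / 2 by rewrite divr_gt0 ?mulr_gt0.
have hE : expR (eta * x) = expR (eta * x / 2) ^+ 2.
  by rewrite expr2 -expRD; congr expR; field.
have h2 : (eta * x / 2) ^+ 2 <= expR (eta * x).
  by rewrite hE; apply: lerXn2r => //; rewrite nnegrE ltW// expR_gt0.
have -> : 4 / eta ^+ 2 / x = x * ((eta * x / 2) ^+ 2)^-1.
  by field; rewrite !gt_eqF.
by rewrite ler_pM2l// lef_pV2 ?posrE ?expR_gt0 ?exprn_gt0.
Qed.

Variables (mu : R) (mn : nat -> nat) (theta : R).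
Hypothesis mu0 : 0 < mu.
Hypothesis lnA : (fun n => (\sum_(0 <= k < n) ln (a k.+1)) / n%:R) @ \oo --> mu.
Hypothesis lnB : (fun k => (ln (b k.+1)) ^+ 2 / k.+1%:R ^+ 2) @ \oo --> (0 : R).
Hypothesis theta1 : theta < 1.
Hypothesis mnn : forall n, (mn n <= n)%N.
Hypothesis mn_theta : \forall n \near \oo, (mn n)%:R <= theta * n%:R.

(** Up to a factor linear in n, the numerator is at most of order e^(nu theta n), while the
    denominator is at least e^((mu - eps) n). These choices give mu - eps - nu theta = eta + 2 eps
    (1 - theta), so the ratio decays at rate [eta] at least. *)
Let eps := (1 - theta) * mu / 6.
Let nu := mu + 2 * eps.
Let eta := (1 - theta) * mu / 2.

Let eps0 : 0 < eps. Proof. by rewrite divr_gt0// mulr_gt0// subr_gt0. Qed.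
Let eta0 : 0 < eta. Proof. by rewrite divr_gt0// mulr_gt0// subr_gt0. Qed.

Let near_Pi : \forall n \near \oo, expR ((mu - eps) * n%:R) <= Pi a n <= expR ((mu + eps) * n%:R).
Proof.
have /cvgrPdist_le/(_ _ eps0) := lnA; apply: filterS2 (nbhs_infty_gt 0) => n n0.
have x0 : 0 < (n%:R : R) by rewrite ltr0n.
rewrite -ln_Pi ler_norml => /andP[h1 h2].
have {}h1 : ln (Pi a n) / n%:R <= mu + eps by lra.
have {}h2 : mu - eps <= ln (Pi a n) / n%:R by lra.
rewrite ler_pdivrMr// in h1; rewrite ler_pdivlMr// in h2.
by rewrite -{1 2}(lnK (Pi_gt0 ok n)) !ler_expR h1 h2.
Qed.

Let near_b : \forall k \near \oo, b k.+1 <= expR (eps * k.+1%:R).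
Proof.
have e2 : 0 < eps ^+ 2 by rewrite exprn_gt0.
have /cvgrPdist_le/(_ _ e2) := lnB; apply: filterS => k.
have x0 : 0 < (k.+1%:R : R) by rewrite ltr0n.
rewrite sub0r normrN ger0_norm; last by rewrite divr_ge0 ?sqr_ge0.
rewrite ler_pdivrMr ?exprn_gt0// -exprMn => h.
have [_ [b0 _]] := ok (ltn0Sn k).
rewrite -{1}(lnK b0) ler_expR leNgt; apply/negP => lt.
have : 0 < eps * k.+1%:R by rewrite mulr_gt0.
nra.
Qed.

Let term_bound : exists2 C, 0 < C &
  forall k, Pi a k * b k.+1 <= C * expR (nu * k.+1%:R).
Proof.
have [N _ hN] : \forall k \near \oo, Pi a k * b k.+1 <= expR (nu * k.+1%:R).
  apply: filterS2 near_Pi near_b => k /andP[_ h1] h2.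
  have [_ [b0 _]] := ok (ltn0Sn k).
  apply: le_trans (ler_pM (ltW (Pi_gt0 ok k)) (ltW b0) h1 h2) _.
  rewrite -expRD ler_expR /nu -natr1.
  have -> : (mu + 2 * eps) * (k%:R + 1) =
    (mu + eps) * k%:R + eps * (k%:R + 1) + (mu + eps) by ring.
  by rewrite lerDl addr_ge0// ltW.
have t0 k : 0 < Pi a k * b k.+1.
  by have [_ [b0 _]] := ok (ltn0Sn k); rewrite mulr_gt0 ?(Pi_gt0 ok).
have nu0 : 0 < nu by apply: addr_gt0 => //; apply: mulr_gt0.
have s0 : 0 <= \sum_(0 <= k < N) Pi a k * b k.+1 by rewrite sumr_ge0// => k _; exact: ltW.
(* The sum absorbs the finitely many terms before the exponential estimate holds. *)
exists (1 + \sum_(0 <= k < N) Pi a k * b k.+1) => [|k]; first by rewrite ltr_pwDl.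
have e1 : 1 <= expR (nu * k.+1%:R).
  by apply: le_trans (expR_ge1Dx _); rewrite lerDl mulr_ge0// ltW.
have [Nk|kN] := leqP N k.
  apply: le_trans (hN k Nk) _; rewrite ler_peMl ?expR_ge0// lerDl//.
apply: (@le_trans _ _ (\sum_(0 <= k < N) Pi a k * b k.+1)).
  rewrite (bigD1_seq k) ?mem_index_iota ?iota_uniq//= lerDl sumr_ge0// => i _; exact: ltW.
apply: (@le_trans _ _ (1 + \sum_(0 <= k < N) Pi a k * b k.+1)); first by rewrite lerDr.
by rewrite ler_peMr// addr_ge0.
Qed.

Lemma fwd_ratio_cvg0 : (fun n => Rn a b (mn n) / (Pi a n + Rn a b n)) @ \oo --> (0 : R).
Proof.
have [C C0 hC] := term_bound.
have nu0 : 0 < nu by apply: addr_gt0 => //; apply: mulr_gt0.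
have RnC m : Rn a b m <= m%:R * (C * expR (nu * m%:R)).
  rewrite /Rn; apply: (@le_trans _ _ (\sum_(1 <= k < m.+1) C * expR (nu * m%:R))).
    rewrite big_nat [leRHS]big_nat; apply: ler_sum => -[//|k] /andP[_ km] /=.
    apply: le_trans (hC k) _; rewrite ler_pM2l// ler_expR ler_pM2l// ler_nat//.
  by rewrite sumr_const_nat subn1 mulr_natl.
have main : \forall n \near \oo, Rn a b (mn n) / (Pi a n + Rn a b n) <=
    C * (4 / eta ^+ 2) / n%:R.
  near=> n.
  have n0 : (0 < n)%N by near: n; exact: nbhs_infty_gt.
  have /andP[h1 _] : expR ((mu - eps) * n%:R) <= Pi a n <= expR ((mu + eps) * n%:R).
    by near: n; exact: near_Pi.
  have h2 : (mn n)%:R <= theta * n%:R by near: n.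
  have x0 : 0 < (n%:R : R) by rewrite ltr0n.
  have R0 := Rn_ge0 ok.
  have P0 := Pi_gt0 ok n.
  apply: (@le_trans _ _ (n%:R * (C * expR (nu * (theta * n%:R))) / expR ((mu - eps) * n%:R))).
    apply: ler_pM => //.
    - by rewrite invr_ge0 addr_ge0// ltW.
    - apply: le_trans (RnC _) _; apply: ler_pM => //.
      + by rewrite mulr_ge0 ?expR_ge0// ltW.
      + by rewrite ler_nat.
      + by rewrite ler_pM2l// ler_expR ler_pM2l.
    - rewrite lef_pV2 ?posrE ?expR_gt0 ?ltr_pwDl//.
      by apply: le_trans h1 _; rewrite lerDl.
  rewrite -expRN -!mulrA -expRD.
  apply: (@le_trans _ _ (C * (n%:R * expR (- (eta * n%:R))))).
    rewrite mulrCA ler_pM2l// ler_pM2l// ler_expR.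
    have -> : - (eta * n%:R) = (nu * theta - (mu - eps)) * n%:R +
       ((- eta - (nu * theta - (mu - eps))) * n%:R) by ring.
    have : 0 <= - eta - (nu * theta - (mu - eps)).
      have -> : - eta - (nu * theta - (mu - eps)) = 2 * eps * (1 - theta).
        by rewrite /nu /eta /eps; field.
      by apply: mulr_ge0; [apply: mulr_ge0 => //; exact: ltW|rewrite subr_ge0 ltW].
    move=> ?; have : 0 <= (- eta - (nu * theta - (mu - eps))) * n%:R by rewrite mulr_ge0.
    lra.
  rewrite ler_pM2l// mulrA; exact: mulr_expN_le.
apply/cvgrPdist_le => e e0; near=> n.
have n0 : (0 < n)%N by near: n; exact: nbhs_infty_gt.
have x0 : 0 < (n%:R : R) by rewrite ltr0n.
rewrite sub0r normrN ger0_norm; last first.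
  by rewrite divr_ge0 ?addr_ge0 ?(Rn_ge0 ok)// ltW// (Pi_gt0 ok).
apply: (@le_trans _ _ (C * (4 / eta ^+ 2) / n%:R)); first by near: n.
rewrite ler_pdivrMr// [e * _]mulrC -ler_pdivrMr//.
by near: n; exact: nbhs_infty_ger.
Unshelve. all: by end_near. Qed.

End GrowthRates.

Lemma limn_esup_lt1 {R : realType} (mn : nat -> nat) :
  (limn_esup (fun n => ((mn n)%:R / n%:R : R)%:E) < 1)%E ->
  exists theta : R, theta < 1 /\ \forall n \near \oo, (mn n)%:R <= theta * n%:R.
Proof.
(* The limit superior is an infimum, over neighbourhoods of infinity, of suprema; one of these
   suprema is already below 1 and serves as theta. *)
move=> /ereal_inf_lt[_ [V [N _ NV] <-]].
set s := ereal_sup _ => s1.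
have us n : (N <= n)%N -> (((mn n)%:R / n%:R : R)%:E <= s)%E.
  by move=> Nn; apply: ereal_sup_ubound; exists n => //; exact: NV.
have s0 : (0 <= s)%E by apply: le_trans (us N (leqnn N)); rewrite lee_fin divr_ge0.
have sfin : s \is a fin_num by rewrite ge0_fin_numE// (lt_trans s1)// ltry.
exists (fine s); split; first by rewrite -lte_fin fineK.
near=> n.
have n0 : 0 < (n%:R : R) by rewrite ltr0n; near: n; exact: nbhs_infty_gt.
rewrite -ler_pdivrMr// -lee_fin fineK//.
by apply: us; near: n; exact: nbhs_infty_ge.
Unshelve. all: by end_near. Qed.

(** * The almost sure forward limit *)

Section AlmostSure.
Context {R : realType} {d : measure_display} {Omega : measurableType d}.
Variables (P : probability Omega R) (A B : nat -> Omega -> R).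
Hypothesis iid : iid_env P A B.
Hypothesis AB1 : forall k, (0 < k)%N ->
  P [set w | 0 < A k w /\ 0 < B k w /\ 1 <= A k w + B k w] = 1%E.

Let mlnA k : measurable_fun setT (fun w => ln (A k.+1 w)).
Proof. exact: (measurableT_comp (@measurable_ln R) (measurable_A iid _)). Qed.

Let lnA_mixin k := isMeasurableFun.Build _ _ _ _ _ (mlnA k).
Let lnA k : {RV P >-> R} := HB.pack (fun w => ln (A k.+1 w)) (lnA_mixin k).

Let lnfst_preimage C : measurable C ->
  measurable ((fun z : R * R => ln z.1) @^-1` C).
Proof.
move=> mC; rewrite -[X in measurable X]setTI.
exact: (measurableT_comp (@measurable_ln R) measurable_fst).
Qed.

Let lnA_ident i C : measurable C -> P (lnA i @^-1` C) = P (lnA 0%N @^-1` C).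
Proof.
move=> mC; have [_ [idd _]] := iid.
exact: (idd i.+1 _ isT (lnfst_preimage mC)).
Qed.

Let lnA_ind i j : i != j -> forall C D, measurable C -> measurable D ->
  P ((lnA i @^-1` C) `&` (lnA j @^-1` D)) = (P (lnA i @^-1` C) * P (lnA j @^-1` D))%E.
Proof.
move=> ij C D mC mD; have [_ [_ ind]] := iid.
pose E k := if k == i.+1 then (fun z : R * R => ln z.1) @^-1` C
  else (fun z : R * R => ln z.1) @^-1` D.
have mE k : measurable (E k) by rewrite /E; case: ifP => _; exact: lnfst_preimage.
have := ind [:: i.+1; j.+1] E; rewrite /= inE eqSS ij => /(_ isT isT mE).
rewrite !big_cons big_nil mule1 /E eqxx eqSS eq_sym (negbTE ij) => <-.
congr (P _); apply/seteqP; split => w /=.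
  move=> [h1 h2] k /=; rewrite !inE => /orP[/eqP ->|/eqP ->].
    by rewrite eqxx.
  by rewrite eqSS eq_sym (negbTE ij).
move=> h; split.
  by have := h i.+1; rewrite /= !inE eqxx /= => /(_ isT).
by have := h j.+1; rewrite /= !inE eqxx orbT eqSS eq_sym (negbTE ij) => /(_ isT).
Qed.

Hypothesis cvR : {ae P, forall w, cvgn (Rinv (A^~ w) (B^~ w))}.
Hypothesis lnA2 : (\int[P]_w ((ln (A 1 w)) ^+ 2)%:E < +oo)%E.
Hypothesis lnB2 : (\int[P]_w ((ln (B 1 w)) ^+ 2)%:E < +oo)%E.

Let mean_gt0 : 0 < rv_mean lnA.
Proof.
have iX := integrable_sq_ident lnA_ident lnA2 0.
rewrite -lte_fin /rv_mean fineK; last exact: integrable_fin_num.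
exact: (drift_mean_gt0 iid AB1 cvR iX).
Qed.

(** All B_k have the same law, so the means of (ln B_k)^2 / k^2 are summable and ln B_k = o(k)
    almost surely. *)
Let lnB_cvg0 : {ae P, forall w,
  (fun k => (ln (B k.+1 w)) ^+ 2 / k.+1%:R ^+ 2) @ \oo --> (0 : R)}.
Proof.
have mlnB k : measurable_fun setT (fun w => ln (B k.+1 w)).
  exact: (measurableT_comp (@measurable_ln R) (measurable_B iid _)).
apply: ae_cvg0_summable => [k|k w|].
- by apply: measurable_funM => //; apply: measurable_funX.
- by rewrite divr_ge0 ?sqr_ge0 ?exprn_ge0.
pose F (x : g_sigma_algebraType (@cylinder R)) := ((ln (pathB x 1%N)) ^+ 2)%:E.
have mF : measurable_fun setT F.
  apply/measurable_EFinP; apply: measurable_funX.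
  exact: (measurableT_comp (@measurable_ln R) (measurable_pathB 1)).
have F0 x : (0 <= F x)%E by rewrite lee_fin sqr_ge0.
have id k : (\int[P]_w ((ln (B k.+1 w)) ^+ 2)%:E = \int[P]_w ((ln (B 1 w)) ^+ 2)%:E)%E.
  have s0 j : (0 < (k + j).+1)%N by [].
  have sI : injective (fun j => (k + j).+1) by move=> i j [] /addnI.
  have t0 j : (0 < j.+1)%N by [].
  have := integral_env_path iid s0 sI t0 succn_inj mF F0.
  by rewrite /F /pathB /env_path /= addn0.
pose c := fine (\int[P]_w ((ln (B 1 w)) ^+ 2)%:E)%E.
have I0 : (0 <= \int[P]_w ((ln (B 1 w)) ^+ 2)%:E)%E.
  by apply: integral_ge0 => w _; rewrite lee_fin sqr_ge0.
have cE : (\int[P]_w ((ln (B 1 w)) ^+ 2)%:E = c%:E)%E by rewrite fineK// ge0_fin_numE.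
have E k : (\int[P]_w ((ln (B k.+1 w)) ^+ 2 / k.+1%:R ^+ 2)%:E = (c * (k.+1%:R ^+ 2)^-1)%:E)%E.
  under eq_integral do rewrite mulrC EFinM.
  rewrite ge0_integralZl//.
  - by rewrite id cE -EFinM mulrC.
  - by apply/measurable_EFinP; apply: measurable_funX.
  - by move=> w _; rewrite lee_fin sqr_ge0.
under eq_eseriesr do rewrite E.
have c0 : 0 <= c by exact: fine_ge0.
apply: (@le_lt_trans _ _ (c * 2)%:E); last exact: ltry.
apply: lime_le.
  by apply: is_cvg_nneseries => k _ _; rewrite lee_fin mulr_ge0// invr_ge0 exprn_ge0.
apply: nearW => n; rewrite sumEFin lee_fin -mulr_sumr ler_wpM2l//.
exact: inv_sq_series.
Qed.

Lemma fwd_ratio_ae_cvg0 (mn : nat -> nat) : (forall n, (mn n <= n)%N) ->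
  (limn_esup (fun n => ((mn n)%:R / n%:R : R)%:E) < 1)%E ->
  {ae P, forall w, (fun n => Rn (A^~ w) (B^~ w) (mn n) /
    (Pi (A^~ w) n + Rn (A^~ w) (B^~ w) n)) @ \oo --> (0 : R)}.
Proof.
move=> mnn /limn_esup_lt1[theta [th1 mnth]].
apply: filterS3 (ae_env_ok iid AB1) (strong_law lnA_ident lnA_ind lnA2) lnB_cvg0.
by move=> w ok lA lB; exact: (fwd_ratio_cvg0 ok mean_gt0 lA lB th1 mnn mnth).
Qed.

End AlmostSure.

Theorem theorem3p4 (R : realType) (d : measure_display) (Omega : measurableType d)
  (P : probability Omega R) (A B : nat -> Omega -> R)
  (lf : R -> R -> nat -> R) :
  (* (e_n)_{n>=1} = ((A_n, B_n))_{n>=1} i.i.d. *)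
  iid_env P A B ->
  (* P(A > 0, B > 0, A + B >= 1) = 1 *)
  (forall k, (0 < k)%N ->
     P [set w | 0 < A k w /\ 0 < B k w /\ 1 <= A k w + B k w] = 1%E) ->
  (* lf a b is the law LF(a,b) *)
  (forall a b, 0 < a -> 0 < b -> 1 <= a + b -> is_LF a b (lf a b)) ->
  (* subcriticality: R^{(-1)}_oo < oo = R_oo a.s. *)
  {ae P, forall w, cvg (Rinv (A^~ w) (B^~ w) @ \oo) /\
                   (Rn (A^~ w) (B^~ w) @ \oo --> +oo)} ->
  (* part (a) *)
  (forall mn : nat -> nat,
     (forall n, (mn n <= n)%N) ->
     (forall M : nat, \forall n \near \oo, (M <= n - mn n)%N) ->
     [/\ (fun n => (\int[P]_w
            (qP_surv (env_fwd lf (A^~ w) (B^~ w) n) n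
                     [set t | (1 < Zmn t (mn n) n)%N])%:E)%E) @ \oo --> 0%E,
         {ae P, forall w,
            (fun n => qP_surv (env_rev lf (A^~ w) (B^~ w) n) n
                        [set t | (1 < Zmn t (mn n) n)%N]) @ \oo --> (0 : R)}
       & (limn_esup (fun n => ((mn n)%:R / n%:R : R)%:E) < 1)%E ->
         (\int[P]_w ((ln (A 1 w)) ^+ 2)%:E < +oo)%E ->
         (\int[P]_w ((ln (B 1 w)) ^+ 2)%:E < +oo)%E ->
         {ae P, forall w,
            (fun n => qP_surv (env_fwd lf (A^~ w) (B^~ w) n) n
                        [set t | (1 < Zmn t (mn n) n)%N]) @ \oo --> (0 : R)}])
  /\
  (* part (b) *)
  (forall m : nat, (0 < m)%N ->
     {ae P, forall w,
        (fun n => tv (reduced_law lf (A^~ w) (B^~ w) m n)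
                     (star_law (A^~ w) (B^~ w) m)) @ \oo --> 0%E}).
Proof.
move=> iid AB1 lfP subcritical.
have cvR : {ae P, forall w, cvgn (Rinv (A^~ w) (B^~ w))}.
  by apply: filterS subcritical => w [].
split=> [mn mnn mnoo|m _]; last exact: reduced_tv_cvg.
split.
- exact: (annealed_gt1_cvg iid AB1 lfP cvR mnn mnoo).
- exact: (reversed_gt1_cvg iid AB1 lfP cvR mnn mnoo).
- move=> mn1 lnA2 lnB2.
  apply: filterS2 (ae_env_ok iid AB1)
    (fwd_ratio_ae_cvg0 iid AB1 cvR lnA2 lnB2 mnn mn1) => w ok h.
  by under eq_fun do rewrite (fwd_gt1 lfP ok)//.
Qed.
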